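(* Suppose $k=k(n)$ satisfies $(\log n)^2\ll k\ll\sqrt n$. Fix $\gamma\in\mathbb R$ and let $$m=\frac{k^2n}{4\log n}\Big(1+\frac{\gamma}{\sqrt{\log n}}\Big)$$ (rounded to an integer). Then, as $n\to\infty$, $$\mathsf{TV}(\mathbb P_1,\mathbb P_0)=1-\Phi\Big(\frac{\gamma}{\sqrt2}\Big)+o(1).$$
   Context: Let $n,m,k$ be positive integers and $N=\binom n2$; all asymptotics are as $n\to\infty$ with $k=k(n)$, $m=m(n)$, and $a\ll b$ means $a/b\to0$. The null distribution $\mathbb P_0$ is the Erdős–Rényi model $G(n,m)$: the uniform distribution over graphs on vertex set $[n]$ with exactly $m$ edges. The planted distribution $\mathbb P_1$ is the law of the random graph obtained as follows: choose a hub vertex $v_*\in[n]$ uniformly at random; choose a uniformly random set $S$ of $k$ of the $n-1$ possible edges incident to $v_*$; then choose a uniformly random set of $m-k$ edges among the $N-k$ possible edges not in $S$; the graph consists of these $m$ edges. $\mathsf{TV}$ denotes total variation distance, and $\Phi$ is the standard normal CDF. *)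

(* Defs.v *)
From HB Require Import structures.
From mathcomp Require Import all_boot all_order all_algebra.
From mathcomp Require Import all_classical all_reals all_analysis.
Set Implicit Arguments. Unset Strict Implicit. Unset Printing Implicit Defensive.
Import Order.TTheory GRing.Theory Num.Theory.
Import numFieldNormedType.Exports.
Local Open Scope classical_set_scope.
Local Open Scope ring_scope.

(* A graph on vertex set [n] = 'I_n is a set of edges; an edge is a
   2-element subset of 'I_n. *)
Definition edges (n : nat) : {set {set 'I_n}} := [set e : {set 'I_n} | #|e| == 2%N].

Definition star (n : nat) (v : 'I_n) : {set {set 'I_n}} :=
  [set e in edges n | v \in e].

Definition unif_subsets (R : realType) (T : finType) (U : {set T}) (j : nat)
  (X : {set T}) : R :=
  if (X \subset U) && (#|X| == j) then ('C(#|U|, j)%:R)^-1 else 0.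

Definition P0 (R : realType) (n m : nat) (G : {set {set 'I_n}}) : R :=
  unif_subsets R (edges n) m G.

(* Planted distribution P_1: hub v uniform in [n]; S uniform k-subset of the
   n-1 edges at v; then a uniform (m-k)-subset of the N-k edges not in S;
   the graph is S together with these edges. *)
Definition P1 (R : realType) (n m k : nat) (G : {set {set 'I_n}}) : R :=
  \sum_(v : 'I_n) (n%:R)^-1 *
    \sum_(S : {set {set 'I_n}})
      unif_subsets R (star v) k S *
      (if S \subset G then unif_subsets R (edges n :\: S) (m - k) (G :\: S)
       else 0).

Definition TV (R : realType) (T : finType) (P Q : T -> R) : R :=
  2^-1 * \sum_(x : T) `|P x - Q x|.

Definition Phi (R : realType) (x : R) : R :=
  fine (normal_prob 0 1 `]-oo, x]).

(* Main.v *)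
(* The likelihood ratio dP_1/dP_0 is the average over the vertices v of
   ell(d_v), where d_v is the degree of v and ell(d) is proportional to 'C(d, k).
   Weighting by ell(d_v) turns the hypergeometric degree into k + J, with J
   hypergeometric, so everything is governed by the tail
   Q(c) = P(ell(k + J) > c). The event that some ell(d_v) exceeds C n gives
   TV >= Q(C n) - 1/C. Conversely, truncating ell at eps n gives a variable of
   mean at least 1 - Q(eps n) whose variance is small, because the degrees of two
   vertices are negatively correlated apart from their common edge; hence
   TV <= Q(eps n) + o(1). Finally J obeys a central limit theorem, by comparing
   ratios of consecutive probabilities with the Gaussian ones, and at
   J = mu + z sqrt mu one has ln ell(k + J) = ln n + (sqrt 2 z - gamma + o(1)) sqrt (ln n),
   so that both Q(C n) and Q(eps n) tend to P(Z > gamma / sqrt 2). *)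
Require Import Defs.
From HB Require Import structures.
From mathcomp Require Import all_boot all_order all_algebra.
From mathcomp Require Import all_classical all_reals all_analysis.
From mathcomp Require Import zify ring lra.
Set Implicit Arguments. Unset Strict Implicit. Unset Printing Implicit Defensive.
Import Order.TTheory GRing.Theory Num.Theory.
Import numFieldNormedType.Exports.
Local Open Scope ring_scope.

(** * Drawing without replacement *)

(** The truncation level is forced to be of order [n]. Without truncation the second moment of [ell]
    under the null law is roughly [n^2], so the diagonal terms of the variance of the average blow
    up; cutting at [eps * n] reduces their total to [eps], and the mass lost is precisely a planted
    tail, the quantity that also bounds TV from below. The shared edge breaks negative correlation
    of two degrees. Its presence is rare, and the excess it causes is controlled by the mean planted
    hub degree, not by the truncation. The constant 1/4 in [m] comes from the mean degree
    [lam = 2 m / n]: at [J = lam], [ln ell] is about [k^2 / (2 lam)], and this equals [ln n] at the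
    threshold. The assumption that [k^2 / n] vanishes removes the corrections for sampling without
    replacement; the assumption that [(ln n)^2 / k] vanishes removes the quadratic Taylor term of
    [ln ell], of order [k (k / lam)^2]. The constants [C] and [eps] shift [ln ell] by a bounded
    amount only, invisible on the scale [sqrt (ln n)]. *)

Section Subsets.
Variables (T : finType) (V : nmodType).
Implicit Types (U A B G : {set T}).

Lemma sum_subsets_split U A (F : {set T} -> V) : A \subset U ->
  \sum_(G : {set T} | G \subset U) F G =
  \sum_(X : {set T} | X \subset A) \sum_(Y : {set T} | Y \subset U :\: A) F (X :|: Y).
Proof.
move=> sAU; rewrite pair_big_dep /=.
rewrite (reindex_onto (fun XY : {set T} * {set T} => XY.1 :|: XY.2)
  (fun G => (G :&: A, G :\: A))) /=; last first.
  by move=> G sG; rewrite setID.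
apply: eq_bigl => -[X Y] /=; apply/idP/idP.
  case/andP=> sXY /eqP[eX eY].
  rewrite -eX subsetIr /= -eY finset.setSD //.
case/andP=> sX sY; rewrite finset.subUset (fintype.subset_trans sX sAU) /=.
rewrite (fintype.subset_trans sY (subsetDl _ _)) /=.
have YA : Y :&: A = finset.set0.
  apply/eqP; rewrite setI_eq0.
  by move: sY; rewrite subsetD => /andP[].
have YA' : Y :\: A = Y.
  by move: sY; rewrite subsetD => /andP[_ /finset.setDidPl].
rewrite xpair_eqE finset.setIUl YA finset.setU0 (finset.setIidPl sX) eqxx /=.
by rewrite finset.setDUl YA'; move: sX; rewrite -finset.setD_eq0 => /eqP->; rewrite finset.set0U.
Qed.

Lemma sum_subsets_card A (F : nat -> V) :
  \sum_(X : {set T} | X \subset A) F #|X| = \sum_(j < #|A|.+1) F j *+ 'C(#|A|, j).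
Proof.
rewrite (partition_big (fun X : {set T} => inord #|X| : 'I_#|A|.+1) xpredT) //=.
apply: eq_bigr => j _.
rewrite (eq_bigr (fun=> F j)); last first.
  move=> X /andP[sX /eqP <-]; rewrite inordK // ltnS; exact: subset_leq_card.
rewrite big_const iter_addr addr0; congr (_ *+ _).
rewrite -cards_draws; apply: eq_card => X; rewrite finset.in_set unfold_in /=.
case sX: (X \subset A) => //=.
by rewrite -val_eqE /= inordK // ltnS; apply: subset_leq_card.
Qed.

End Subsets.

(* The cut-off makes [binm L M s] vanish for [s > M], where truncated
   subtraction would give ['C(L, 0) = 1]. *)
Definition binm (L M s : nat) : nat := if (s <= M)%N then 'C(L, M - s) else 0.

Section Draws.
Variables (T : finType) (V : nmodType).
Implicit Types (U A B G : {set T}).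

Lemma sum_draws_const U M s (x : V) :
  \sum_(Y : {set T} | Y \subset U) (if (s + #|Y| == M)%N then x else 0) =
  x *+ binm #|U| M s.
Proof.
rewrite -big_mkcondr /= big_const iter_addr addr0; congr (_ *+ _).
rewrite /binm; case: leqP => sM.
  rewrite -cards_draws; apply: eq_card => X; rewrite finset.in_set unfold_in /=.
  by congr (_ && _); apply/eqP/eqP; lia.
apply: eq_card0 => X; rewrite unfold_in; apply/negP => /andP[_ /eqP]; lia.
Qed.

Lemma sum_draws1 U A M (F : nat -> V) : A \subset U ->
  \sum_(G : {set T} | (G \subset U) && (#|G| == M)) F #|G :&: A| =
  \sum_(a < #|A|.+1) F a *+ ('C(#|A|, a) * binm #|U :\: A| M a).
Proof.
move=> sA; rewrite big_mkcondr /= (sum_subsets_split _ sA).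
rewrite (eq_bigr (fun X : {set T} => F #|X| *+ binm #|U :\: A| M #|X|)); last first.
  move=> X sX; rewrite -sum_draws_const; apply: eq_bigr => Y.
  rewrite subsetD => /andP[_ dYA].
  have YA : Y :&: A = finset.set0 by apply/eqP; rewrite setI_eq0.
  have XY : X :&: Y = finset.set0.
    apply/eqP; rewrite setI_eq0 disjoint_sym; exact: disjointWr sX dYA.
  by rewrite cardsU XY cards0 subn0 finset.setIUl YA finset.setU0 (finset.setIidPl sX).
rewrite (sum_subsets_card A (fun j => F j *+ binm #|U :\: A| M j)).
by apply: eq_bigr => a _; rewrite mulrnAC -mulrnA.
Qed.

(** The two counts interact only through [binm _ M (a + b)], which depends on their sum;
    log-concavity of that factor is what will give negative correlation. *)
Lemma sum_draws2 U A B M (F : nat -> nat -> V) : A \subset U -> B \subset U ->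
  [disjoint A & B] ->
  \sum_(G : {set T} | (G \subset U) && (#|G| == M)) F #|G :&: A| #|G :&: B| =
  \sum_(a < #|A|.+1) \sum_(b < #|B|.+1)
    F a b *+ ('C(#|A|, a) * 'C(#|B|, b) * binm #|U :\: A :\: B| M (a + b)).
Proof.
move=> sA sB dAB; have sB' : B \subset U :\: A by rewrite subsetD sB disjoint_sym.
rewrite big_mkcondr /= (sum_subsets_split _ sA).
rewrite (eq_bigr (fun X : {set T} => \sum_(b < #|B|.+1)
    F #|X| b *+ ('C(#|B|, b) * binm #|U :\: A :\: B| M (#|X| + b)))); last first.
  move=> X sX; rewrite (sum_subsets_split _ sB').
  transitivity (\sum_(Y : {set T} | Y \subset B)
     (fun b => F #|X| b *+ (binm #|U :\: A :\: B| M (#|X| + b))) #|Y|).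
    apply: eq_bigr => Y sY; rewrite -sum_draws_const; apply: eq_bigr => Z.
    rewrite !subsetD => /andP[/andP[_ dZA] dZB].
    have ZA : Z :&: A = finset.set0 by apply/eqP; rewrite setI_eq0.
    have ZB : Z :&: B = finset.set0 by apply/eqP; rewrite setI_eq0.
    have YZ : Y :&: Z = finset.set0.
      apply/eqP; rewrite setI_eq0 disjoint_sym; exact: disjointWr sY dZB.
    have XZ : X :&: Z = finset.set0.
      apply/eqP; rewrite setI_eq0 disjoint_sym; exact: disjointWr sX dZA.
    have YA : Y :&: A = finset.set0.
      apply/eqP; rewrite setI_eq0; apply: disjointWl sY _; by rewrite disjoint_sym.
    have XB : X :&: B = finset.set0.
      apply/eqP; rewrite setI_eq0; exact: disjointWl sX dAB.
    have XY : X :&: Y = finset.set0.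
      apply/eqP; rewrite -finset.subset0 -XB; exact: finset.setIS.
    rewrite !cardsU finset.setIUr XY XZ YZ finset.setU0 cards0 !subn0 addnA.
    by rewrite !finset.setIUl YA ZA XB ZB !finset.setU0 finset.set0U
      (finset.setIidPl sX) (finset.setIidPl sY).
  rewrite (sum_subsets_card B
    (fun b => F #|X| b *+ (binm #|U :\: A :\: B| M (#|X| + b)))).
  by apply: eq_bigr => b _; rewrite mulrnAC -mulrnA.
rewrite (sum_subsets_card A (fun a => \sum_(b < #|B|.+1) F a b *+ ('C(#|B|, b) *
   binm #|U :\: A :\: B| M (a + b)))).
apply: eq_bigr => a _; rewrite -sumrMnl; apply: eq_bigr => b _.
by rewrite -mulrnA mulnC mulnA.
Qed.

End Draws.

(** * Log-concavity, size bias and negative correlation *)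

Lemma bin_log_concave1 L e x :
  ('C(L, e) * 'C(L, (e + x).+1) <= 'C(L, e.+1) * 'C(L, e + x))%N.
Proof.
have h1 := mul_bin_left L e; have h2 := mul_bin_left L (e + x).
rewrite -(@leq_pmul2l (e.+1 * (e + x).+1)) //.
have -> : (e.+1 * (e + x).+1 * ('C(L, e) * 'C(L, (e + x).+1)) =
  e.+1 * 'C(L, e) * ((L - (e + x)) * 'C(L, e + x)))%N by rewrite -h2; ring.
have -> : (e.+1 * (e + x).+1 * ('C(L, e.+1) * 'C(L, e + x)) =
  (e + x).+1 * 'C(L, e + x) * ((L - e) * 'C(L, e)))%N by rewrite -h1; ring.
have -> : (e.+1 * 'C(L, e) * ((L - (e + x)) * 'C(L, e + x)) =
   e.+1 * (L - (e + x)) * ('C(L, e) * 'C(L, e + x)))%N by ring.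
have -> : ((e + x).+1 * 'C(L, e + x) * ((L - e) * 'C(L, e)) =
  (e + x).+1 * (L - e) * ('C(L, e) * 'C(L, e + x)))%N by ring.
by rewrite leq_mul2r leq_mul ?orbT // ?ltnS; lia.
Qed.

(** Each induction step multiplies by the one-step inequality and cancels
    ['C(L, e + x + y) * 'C(L, e + y)]. These must be positive, hence the case split: past [L] the
    left side is already zero. *)
Lemma bin_log_concave L e x y :
  ('C(L, e) * 'C(L, e + x + y) <= 'C(L, e + x) * 'C(L, e + y))%N.
Proof.
elim: y => [|y IH]; first by rewrite !addn0 mulnC.
case: (leqP (e + x + y.+1) L) => hL; last by rewrite (bin_small hL) muln0.
have st := bin_log_concave1 L (e + y) x.
have p1 : (0 < 'C(L, e + x + y))%N by rewrite bin_gt0; lia.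
have p2 : (0 < 'C(L, e + y))%N by rewrite bin_gt0; lia.
have := leq_mul IH st.
have -> : (e + y + x = e + x + y)%N by lia.
rewrite -!addnS => h.
rewrite -(@leq_pmul2l ('C(L, e + x + y) * 'C(L, e + y))) ?muln_gt0 ?p1 //.
by apply: leq_trans (leq_trans h _); rewrite leq_eqVlt; apply/orP; left; apply/eqP; ring.
Qed.

(** Reverse total positivity of order two: drawing more from one set leaves fewer draws for the
    other. If [a' + b' > M] the cut-off in [binm] makes the left side vanish. *)
Lemma binm_log_concave L M a a' b b' : (a <= a')%N -> (b <= b')%N ->
  (binm L M (a + b) * binm L M (a' + b') <= binm L M (a + b') * binm L M (a' + b))%N.
Proof.
move=> ha hb; rewrite {2}/binm; case: (leqP (a' + b') M) => hM; last by rewrite muln0.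
rewrite /binm !ifT; try lia.
have := bin_log_concave L (M - (a' + b')) (a' - a) (b' - b).
have -> : (M - (a' + b') + (a' - a) + (b' - b) = M - (a + b))%N by lia.
have -> : (M - (a' + b') + (a' - a) = M - (a + b'))%N by lia.
have -> : (M - (a' + b') + (b' - b) = M - (a' + b))%N by lia.
by rewrite mulnC.
Qed.

Lemma binm_shift L m k j : (k <= m)%N -> binm L m (k + j) = binm L (m - k) j.
Proof.
by move=> km; rewrite /binm; case: leqP => h1; case: leqP => h2 //; try lia; rewrite subnDA.
Qed.

Lemma sum_bin_binm K L M : (\sum_(j < K.+1) 'C(K, j) * binm L M j = 'C(K + L, M))%N.
Proof.
rewrite -binomial.Vandermonde.
rewrite (big_ord_widen (maxn K.+1 M.+1) (fun j => 'C(K, j) * binm L M j)%N) ?leq_maxl //.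
rewrite (big_ord_widen (maxn K.+1 M.+1) (fun j => 'C(K, j) * 'C(L, M - j))%N) ?leq_maxr //.
rewrite big_mkcond /= [RHS]big_mkcond /=; apply: eq_bigr => j _.
rewrite /binm !ltnS; case: (leqP j K) => h1; case: (leqP j M) => h2;
  by rewrite ?muln0 ?(bin_small h1).
Qed.

(** Choosing [d] out of [K] and then [k] of these amounts to choosing the [k] first and the other
    [d - k] afterwards. The terms with [d < k] vanish. *)
Lemma sum_size_bias (V : nmodType) K k (F : nat -> V) : (k <= K)%N ->
  \sum_(d < K.+1) F d *+ ('C(K, d) * 'C(d, k)) =
  \sum_(j < (K - k).+1) F (k + j)%N *+ ('C(K, k) * 'C(K - k, j)).
Proof.
move=> kK.
have -> : K.+1 = (k + (K - k).+1)%N by lia.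
rewrite big_split_ord /= [X in X + _]big1 ?add0r; last first.
  by move=> i _; rewrite [X in (_ * X)%N]bin_small ?muln0.
apply: eq_bigr => j _; congr (_ *+ _).
have hj : (j <= K - k)%N by rewrite -ltnS.
have f0 : (0 < k`! * j`! * (K - k - j)`!)%N by rewrite !muln_gt0 !fact_gt0.
have e1 := @bin_fact K k kK.
have e2 := @bin_fact (K - k) j hj.
have e3 := @bin_fact K (k + j) ltac:(lia).
have e4 := @bin_fact (k + j) k (leq_addr _ _).
rewrite -subnDA in e2 f0.
have e5 : (k + j - k = j)%N by lia.
rewrite e5 in e4.
apply/eqP; rewrite -(eqn_pmul2r f0); apply/eqP.
transitivity (K`!)%N; first by rewrite -e3 -e4; ring.
by rewrite -e1 -e2; ring.
Qed.

(** A Chebyshev association inequality. Symmetrised over swaps, the difference of the sides has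
    terms [(c a b * c a' b' - c a b' * c a' b) * ((f a - f a') * (h b' - h b))], all nonnegative.
    The weights stay unnormalised, so no division occurs. *)
Lemma negative_correlation (R : realDomainType) p q (c : nat -> nat -> R) (f h : nat -> R) :
  {homo f : x y / (x <= y)%N >-> x <= y} ->
  {homo h : x y / (x <= y)%N >-> x <= y} ->
  (forall a a' b b', (a <= a')%N -> (b <= b')%N ->
     c a b * c a' b' <= c a b' * c a' b) ->
  (\sum_(a < p) \sum_(b < q) c a b * (f a * h b)) * (\sum_(a < p) \sum_(b < q) c a b) <=
  (\sum_(a < p) \sum_(b < q) c a b * f a) * (\sum_(a < p) \sum_(b < q) c a b * h b).
Proof.
move=> hf hh hc; rewrite -subr_ge0.
pose T (a a' b b' : nat) := c a b * c a' b' * (f a * (h b' - h b)).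
set X := _ - _.
have XE : X = \sum_(a < p) \sum_(a' < p) \sum_(b < q) \sum_(b' < q) T a a' b b'.
  have prodE (u v : nat -> nat -> R) :
    (\sum_(a < p) \sum_(b < q) u a b) * (\sum_(a < p) \sum_(b < q) v a b) =
    \sum_(a < p) \sum_(a' < p) \sum_(b < q) \sum_(b' < q) u a b * v a' b'.
    rewrite big_distrl /=; apply: eq_bigr => a _.
    rewrite big_distrr /=; apply: eq_bigr => a' _.
    rewrite big_distrl /=; apply: eq_bigr => b _.
    by rewrite big_distrr.
  rewrite /X (prodE (fun a b => c a b * (f a * h b)) c).
  rewrite (prodE (fun a b => c a b * f a) (fun a b => c a b * h b)).
  rewrite -sumrB; apply: eq_bigr => a _; rewrite -sumrB; apply: eq_bigr => a' _.
  rewrite -sumrB; apply: eq_bigr => b _; rewrite -sumrB; apply: eq_bigr => b' _.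
  by rewrite /T; ring.
(* Averaging over the swaps of [a, a'] and of [b, b'] makes every term signed. *)
have XE2 : X = \sum_(a < p) \sum_(a' < p) \sum_(b < q) \sum_(b' < q) T a a' b' b.
  by rewrite XE; apply: eq_bigr => a _; apply: eq_bigr => a' _; rewrite exchange_big.
have X2 : X + X = \sum_(a < p) \sum_(a' < p) \sum_(b < q) \sum_(b' < q)
    (c a b * c a' b' - c a b' * c a' b) * (f a * (h b' - h b)).
  rewrite {1}XE XE2 -big_split; apply: eq_bigr => a _; rewrite -big_split.
  apply: eq_bigr => a' _; rewrite -big_split; apply: eq_bigr => b _.
  by rewrite -big_split; apply: eq_bigr => b' _; rewrite /T /=; ring.
have X4 : (X + X) + (X + X) = \sum_(a < p) \sum_(a' < p) \sum_(b < q) \sum_(b' < q)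
    (c a b * c a' b' - c a b' * c a' b) * ((f a - f a') * (h b' - h b)).
  rewrite {1}X2 X2 [X in _ + X]exchange_big /=.
  rewrite -big_split; apply: eq_bigr => a _; rewrite -big_split.
  apply: eq_bigr => a' _; rewrite -big_split; apply: eq_bigr => b _.
  by rewrite -big_split; apply: eq_bigr => b' _; rewrite /=; ring.
suff : 0 <= (X + X) + (X + X) by move=> ?; lra.
rewrite X4; apply: sumr_ge0 => a _; apply: sumr_ge0 => a' _.
apply: sumr_ge0 => b _; apply: sumr_ge0 => b' _.
case: (leqP a a') => [|/ltnW] ha; case: (leqP b b') => [|/ltnW] hb;
  have := hc _ _ _ _ ha hb; have := hf _ _ ha; have := hh _ _ hb => h1 h2 h3.
- apply: mulr_le0; first by rewrite subr_le0.
  by apply: mulr_le0_ge0; rewrite ?subr_le0 ?subr_ge0.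
- apply: mulr_ge0; first by rewrite subr_ge0.
  by apply: mulr_le0; rewrite subr_le0.
- apply: mulr_ge0; first by rewrite subr_ge0 mulrC [leRHS]mulrC.
  by apply: mulr_ge0; rewrite subr_ge0.
- apply: mulr_le0; first by rewrite subr_le0 mulrC [leRHS]mulrC.
  by apply: mulr_ge0_le0; rewrite ?subr_le0 ?subr_ge0.
Qed.

(** * Means over uniform subsets and hypergeometric means *)

Section Means.
Variable R : realType.

Definition draws_mean (T : finType) (U : {set T}) M (F : {set T} -> R) : R :=
  ('C(#|U|, M)%:R)^-1 * \sum_(G : {set T} | (G \subset U) && (#|G| == M)) F G.

(** The hypergeometric expectation: [M] draws from [K] marked and [L] unmarked items, [j] being the
    number of marked items drawn. *)
Definition hyp_mean K L M (F : nat -> R) : R :=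
  ('C(K + L, M)%:R)^-1 * \sum_(j < K.+1) ('C(K, j) * binm L M j)%:R * F j.

Lemma hyp_mean_const K L M (c : R) : (M <= K + L)%N -> hyp_mean K L M (fun=> c) = c.
Proof.
move=> hM; rewrite /hyp_mean -mulr_suml -natr_sum sum_bin_binm mulrA mulVf ?mul1r //.
by rewrite pnatr_eq0 -lt0n bin_gt0.
Qed.

Lemma ler_hyp_mean K L M (F G : nat -> R) : (forall j, (j <= K)%N -> F j <= G j) ->
  hyp_mean K L M F <= hyp_mean K L M G.
Proof.
move=> h; rewrite /hyp_mean ler_wpM2l ?invr_ge0 //.
by apply: ler_sum => j _; rewrite ler_wpM2l // h // -ltnS.
Qed.

Lemma hyp_meanD K L M (F G : nat -> R) :
  hyp_mean K L M (fun j => F j + G j) = hyp_mean K L M F + hyp_mean K L M G.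
Proof.
by rewrite /hyp_mean -mulrDr -big_split; congr (_ * _); apply: eq_bigr => j _; rewrite mulrDr.
Qed.

Lemma hyp_meanZ K L M (c : R) (F : nat -> R) :
  hyp_mean K L M (fun j => c * F j) = c * hyp_mean K L M F.
Proof.
rewrite /hyp_mean mulrCA; congr (_ * _).
by rewrite mulr_sumr; apply: eq_bigr => j _; rewrite mulrCA.
Qed.

Lemma eq_hyp_mean K L M (F G : nat -> R) : F =1 G -> hyp_mean K L M F = hyp_mean K L M G.
Proof. by move=> FG; congr (_ * _); apply: eq_bigr => j _; rewrite FG. Qed.

(** The prefactor is the mean of ['C(d, k)]. With the planted [k] this is the change of measure from
    null to hub degree; with 1 or 2 for [k] it gives the first two moments. *)
Lemma hyp_mean_size_bias K L M k (F : nat -> R) : (k <= K)%N -> (k <= M)%N -> (M <= K + L)%N ->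
  hyp_mean K L M (fun d => 'C(d, k)%:R * F d) =
  'C(K, k)%:R * 'C(K - k + L, M - k)%:R / 'C(K + L, M)%:R *
  hyp_mean (K - k) L (M - k) (fun j => F (k + j)%N).
Proof.
move=> kK kM hM; rewrite /hyp_mean.
have -> : \sum_(j < K.+1) ('C(K, j) * binm L M j)%:R * ('C(j, k)%:R * F j) =
  \sum_(d < K.+1) ((binm L M d)%:R * F d) *+ ('C(K, d) * 'C(d, k)).
  by apply: eq_bigr => d _; rewrite -[RHS]mulr_natr !natrM; ring.
rewrite (sum_size_bias (fun d => (binm L M d)%:R * F d) kK).
have -> : \sum_(j < (K - k).+1) ((binm L M (k + j))%:R * F (k + j)%N) *+ ('C(K, k) * 'C(K - k, j))
  = 'C(K, k)%:R * \sum_(j < (K - k).+1) ('C(K - k, j) * binm L (M - k) j)%:R * F (k + j)%N.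
  rewrite mulr_sumr; apply: eq_bigr => j _.
  by rewrite binm_shift // -[LHS]mulr_natr !natrM; ring.
have h1 : ('C(K + L, M)%:R : R) != 0 by rewrite pnatr_eq0 -lt0n bin_gt0.
have h2 : ('C(K - k + L, M - k)%:R : R) != 0 by rewrite pnatr_eq0 -lt0n bin_gt0; lia.
by field; rewrite h1 h2.
Qed.

Lemma draws_mean_count (T : finType) (U A : {set T}) M (F : nat -> R) : A \subset U ->
  draws_mean U M (fun G => F #|G :&: A|) = hyp_mean #|A| #|U :\: A| M F.
Proof.
move=> sA; rewrite /draws_mean /hyp_mean sum_draws1 //.
have -> : (#|A| + #|U :\: A| = #|U|)%N.
  by rewrite -(cardsID A U) (finset.setIidPr sA).
by congr (_ * _); apply: eq_bigr => a _; rewrite -[LHS]mulr_natl.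
Qed.

Lemma ler_draws_mean (T : finType) (U : {set T}) M (F H : {set T} -> R) :
  (forall G : {set T}, G \subset U -> F G <= H G) -> draws_mean U M F <= draws_mean U M H.
Proof.
move=> h; rewrite /draws_mean ler_wpM2l ?invr_ge0 //.
by apply: ler_sum => G /andP[/h].
Qed.

Lemma eq_draws_mean (T : finType) (U : {set T}) M (F H : {set T} -> R) :
  (forall G : {set T}, G \subset U -> F G = H G) -> draws_mean U M F = draws_mean U M H.
Proof. by move=> h; congr (_ * _); apply: eq_bigr => G /andP[/h]. Qed.

Lemma draws_meanD (T : finType) (U : {set T}) M (F H : {set T} -> R) :
  draws_mean U M (fun G => F G + H G) = draws_mean U M F + draws_mean U M H.
Proof. by rewrite /draws_mean -mulrDr -big_split. Qed.

Lemma draws_meanZ (T : finType) (U : {set T}) M c (F : {set T} -> R) :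
  draws_mean U M (fun G => c * F G) = c * draws_mean U M F.
Proof. by rewrite /draws_mean -mulr_sumr mulrCA. Qed.

Lemma draws_mean_sum (T : finType) (U : {set T}) M (I : finType) (P : pred I)
    (F : I -> {set T} -> R) :
  draws_mean U M (fun G => \sum_(i | P i) F i G) = \sum_(i | P i) draws_mean U M (F i).
Proof. by rewrite /draws_mean exchange_big /= mulr_sumr. Qed.

Lemma draws_mean_const (T : finType) (U : {set T}) M (c : R) : (M <= #|U|)%N ->
  draws_mean U M (fun=> c) = c.
Proof.
move=> hM.
have := @draws_mean_count T U finset.set0 M (fun=> c) (finset.sub0set U).
by rewrite finset.setD0 cards0 hyp_mean_const.
Qed.

Lemma draws_mean_neg_corr (T : finType) (U A B : {set T}) M (f h : nat -> R) :
  (M <= #|U|)%N -> A \subset U -> B \subset U -> [disjoint A & B] ->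
  {homo f : x y / (x <= y)%N >-> x <= y} ->
  {homo h : x y / (x <= y)%N >-> x <= y} ->
  draws_mean U M (fun G => f #|G :&: A| * h #|G :&: B|) <=
  draws_mean U M (fun G => f #|G :&: A|) * draws_mean U M (fun G => h #|G :&: B|).
Proof.
move=> hM sA sB dAB hf hh.
pose c (a b : nat) : R := ('C(#|A|, a) * 'C(#|B|, b) * binm #|U :\: A :\: B| M (a + b))%:R.
have dE (F : nat -> nat -> R) : draws_mean U M (fun G => F #|G :&: A| #|G :&: B|) =
    ('C(#|U|, M)%:R)^-1 * \sum_(a < #|A|.+1) \sum_(b < #|B|.+1) c a b * F a b.
  rewrite /draws_mean sum_draws2 //; congr (_ * _).
  by apply: eq_bigr => a _; apply: eq_bigr => b _; rewrite -[LHS]mulr_natl.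
have c0 : 0 < ('C(#|U|, M)%:R : R) by rewrite ltr0n bin_gt0.
(* The constant function 1 identifies the total weight, by which the unnormalised inequality has to
   be divided. *)
have s1 : \sum_(a < #|A|.+1) \sum_(b < #|B|.+1) c a b = 'C(#|U|, M)%:R.
  have := dE (fun _ _ => 1); rewrite draws_mean_const // => /(congr1 (fun x => 'C(#|U|, M)%:R * x)).
  rewrite mulrA divff ?gt_eqF // mul1r mulr1 => ->.
  by apply: eq_bigr => a _; apply: eq_bigr => b _; rewrite mulr1.
rewrite (dE (fun a b => f a * h b)) (dE (fun a _ => f a)) (dE (fun _ b => h b)).
rewrite mulrACA -[leRHS]mulrA ler_pM2l ?invr_gt0 // ler_pdivlMl // mulrC -s1.
apply: negative_correlation => // a a' b b' ha hb.
rewrite /c -!natrM ler_nat.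
have := binm_log_concave #|U :\: A :\: B| M ha hb.
set w := ('C(#|A|, a) * 'C(#|B|, b) * ('C(#|A|, a') * 'C(#|B|, b')))%N => hw.
have := leq_mul (leqnn w) hw; rewrite /w; set x := (leqLHS); set y := (leqRHS).
move=> hxy; apply: leq_trans (leq_trans _ hxy) _; rewrite /x /y leq_eqVlt;
  apply/orP; left; apply/eqP; ring.
Qed.

End Means.

(** * Likelihood ratio and total variation *)

Section Stars.
Variable n : nat.
Implicit Types v w : 'I_n.

Lemma card_edges : #|edges n| = 'C(n, 2).
Proof. by rewrite /edges card_draws card_ord. Qed.

Lemma starS v : star v \subset edges n.
Proof. by apply/fintype.subsetP => e; rewrite /star finset.inE => /andP[]. Qed.

Lemma starE v : star v = [set [set v; w] | w in [set~ v]].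
Proof.
apply/setP => e; rewrite /star /edges !finset.inE; apply/andP/imsetP.
  case=> /cards2P[x [y [xy ->]]]; rewrite !finset.inE => /orP[] /eqP ->.
    by exists y; rewrite // !finset.inE eq_sym.
  by exists x; [rewrite !finset.inE | rewrite finset.setUC].
case=> w; rewrite !finset.inE => wv ->.
by rewrite cards2 (eq_sym v w) wv !finset.inE eqxx.
Qed.

Lemma card_star v : #|star v| = n.-1.
Proof.
rewrite starE card_in_imset; first by rewrite cardsC1 card_ord.
move=> x y; rewrite !finset.inE => xv yv /setP/(_ x).
by rewrite !finset.inE eqxx (negbTE xv) /= => /esym/eqP.
Qed.

Lemma starI v w : v != w -> star v :&: star w = [set [set v; w]].
Proof.
move=> vw; apply/setP => e; rewrite /star /edges !finset.inE; apply/idP/eqP.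
  case/andP=> /andP[/cards2P[x [y [xy ->]]]]; rewrite !finset.inE.
  move=> hv /andP[_ hw]; apply/setP => z; rewrite !finset.inE.
  case/orP: hv => /eqP ev; case/orP: hw => /eqP ew; subst; rewrite ?eqxx ?orbT // in vw *.
  by rewrite orbC.
by move=> ->; rewrite cards2 vw !finset.inE !eqxx orbT.
Qed.

Lemma set2_star v w : v != w -> [set v; w] \in star v.
Proof. by move=> vw; rewrite /star /edges !finset.inE cards2 vw eqxx. Qed.

End Stars.

Lemma leq_pred_bin2 n : (n.-1 <= 'C(n, 2))%N.
Proof. by case: n => // n; rewrite binS bin1 /=; lia. Qed.

Section Density.
Variables (R : realType) (n m k : nat).
Hypotheses (kn : (k <= n.-1)%N) (km : (k <= m)%N) (mN : (m <= 'C(n, 2))%N).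

(** Given the hub [v], a graph with [m] edges arises from each of the ['C(d, k)] choices of [S]
    among its edges at [v], with weight [1 / ('C(n.-1, k) * 'C('C(n, 2) - k, m - k))] each; this is
    divided by the null weight [1 / 'C('C(n, 2), m)]. *)
Definition ell (d : nat) : R :=
  ('C(d, k) * 'C('C(n, 2), m))%:R / ('C(n.-1, k) * 'C('C(n, 2) - k, m - k))%:R.

Lemma ell_ge0 d : 0 <= ell d.
Proof. by rewrite divr_ge0. Qed.

Lemma ell_homo : {homo ell : a b / (a <= b)%N >-> a <= b}.
Proof.
move=> a b ab; rewrite /ell ler_wpM2r ?invr_ge0 // ler_nat leq_mul2r leq_bin2l ?orbT //.
Qed.

Lemma P0_mean (F : {set {set 'I_n}} -> R) :
  \sum_G P0 R m G * F G = draws_mean (edges n) m F.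
Proof.
rewrite /draws_mean mulr_sumr [RHS]big_mkcond; apply: eq_bigr => G _.
by rewrite /P0 /unif_subsets; case: ifP; rewrite // mul0r.
Qed.

Lemma P1_density (G : {set {set 'I_n}}) :
  P1 R m k G = P0 R m G * (n%:R^-1 * \sum_(v : 'I_n) ell #|G :&: star v|).
Proof.
rewrite /P1 mulrCA !mulr_sumr; apply: eq_bigr => v _; congr (_ * _).
rewrite /P0 /unif_subsets card_edges card_star.
pose ind := (G \subset edges n) && (#|G| == m).
(* All contributing [S] carry the same weight, and they are the [k]-subsets of [G :&: star v], so
   the inner sum becomes a count. *)
have hS (S : {set {set 'I_n}}) :
  (if (S \subset star v) && (#|S| == k) then ('C(n.-1, k)%:R)^-1 else 0) *
  (if S \subset G then
     if (G :\: S \subset edges n :\: S) && (#|G :\: S| == (m - k)%N) then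
       ('C(#|edges n :\: S|, m - k)%:R)^-1 else 0 else 0) =
  if (S \subset G :&: star v) && (#|S| == k) then
    (if ind then ('C(n.-1, k)%:R)^-1 * ('C('C(n, 2) - k, m - k)%:R)^-1 else 0) else 0 :> R.
  rewrite finset.subsetI.
  case sS : (S \subset star v); rewrite /= ?andbF ?mul0r //.
  case cS : (#|S| == k); rewrite /= ?andbF ?mul0r //.
  case SG : (S \subset G); rewrite /= ?mulr0 //.
  have SE : S \subset edges n := fintype.subset_trans sS (starS v).
  rewrite !cardsD (finset.setIidPr SE) (finset.setIidPr SG) card_edges (eqP cS).
  have -> : (G :\: S \subset edges n :\: S) = (G \subset edges n).
    apply/idP/idP => h; last exact: finset.setSD.
    rewrite -(setID G S) (finset.setIidPr SG) finset.subUset SE /=.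
    exact: fintype.subset_trans h (subsetDl _ _).
  have kG : (k <= #|G|)%N by rewrite -(eqP cS) subset_leq_card.
  have -> : (#|G| - k == m - k)%N = (#|G| == m) by apply/eqP/eqP; lia.
  by rewrite -/ind; case: ind; rewrite ?mulr0.
rewrite (eq_bigr _ (fun S _ => hS S)) -big_mkcond /= sumr_const.
rewrite -/ind; clear hS; have -> : #|[pred S : {set {set 'I_n}} | (S \subset G :&: star v) && (#|S| == k)]| =
   'C(#|G :&: star v|, k).
  by rewrite -cards_draws; apply: eq_card => X; rewrite finset.in_set unfold_in /=.
case: ind; last by rewrite mul0rn mul0r.
rewrite /ell !natrM -mulr_natr.
have h : ('C('C(n, 2), m)%:R : R) != 0 by rewrite pnatr_eq0 -lt0n bin_gt0.
have h1 : ('C(n.-1, k)%:R : R) != 0 by rewrite pnatr_eq0 -lt0n bin_gt0.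
have h2 : ('C('C(n, 2) - k, m - k)%:R : R) != 0 by rewrite pnatr_eq0 -lt0n bin_gt0; lia.
by field; rewrite h h1 h2.
Qed.

Lemma degree_mean (v : 'I_n) (F : nat -> R) :
  draws_mean (edges n) m (fun G => F #|G :&: star v|) =
  hyp_mean n.-1 ('C(n, 2) - n.-1) m F.
Proof.
rewrite draws_mean_count ?starS // cardsD (finset.setIidPr (starS v)).
by rewrite card_edges card_star.
Qed.

(** Tilting the null degree law by [ell] yields the law of the hub degree [k + J]; the constants of
    [ell] cancel the prefactor of the size bias. *)
Lemma ell_mean (F : nat -> R) :
  hyp_mean n.-1 ('C(n, 2) - n.-1) m (fun d => ell d * F d) =
  hyp_mean (n.-1 - k) ('C(n, 2) - n.-1) (m - k) (fun j => F (k + j)%N).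
Proof.
have nN := leq_pred_bin2 n.
rewrite (eq_hyp_mean _ _ _ (G := fun d => ('C('C(n, 2), m)%:R /
   ('C(n.-1, k) * 'C('C(n, 2) - k, m - k))%:R) * ('C(d, k)%:R * F d))); last first.
  by move=> d; rewrite /ell natrM; ring.
rewrite hyp_meanZ hyp_mean_size_bias //; last by rewrite subnKC.
have -> : (n.-1 - k + ('C(n, 2) - n.-1) = 'C(n, 2) - k)%N by lia.
rewrite subnKC // mulrA -[RHS]mul1r; congr (_ * _); rewrite natrM.
have h : ('C('C(n, 2), m)%:R : R) != 0 by rewrite pnatr_eq0 -lt0n bin_gt0.
have h1 : ('C(n.-1, k)%:R : R) != 0 by rewrite pnatr_eq0 -lt0n bin_gt0.
have h2 : ('C('C(n, 2) - k, m - k)%:R : R) != 0 by rewrite pnatr_eq0 -lt0n bin_gt0; lia.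
by field; rewrite h h1 h2.
Qed.

End Density.

(** * Joint behaviour of two degrees *)

Section Bounds.
Variable R : realType.

(* Conditioning on whether the element [e] is drawn. *)
Lemma draws_mean_split1 (T : finType) (U : {set T}) e M (F : {set T} -> R) :
  e \in U -> (0 < M)%N -> (M < #|U|)%N ->
  draws_mean U M F = (1 - M%:R / #|U|%:R) * draws_mean (U :\ e) M F +
    M%:R / #|U|%:R * draws_mean (U :\ e) M.-1 (fun G => F (e |: G)).
Proof.
move=> eU M0 MU; rewrite /draws_mean.
have cU : #|U :\ e| = #|U|.-1 by rewrite (cardsD1 e U) eU.
rewrite (bigID (fun G : {set T} => e \in G)) /= addrC mulrDr cU; congr (_ + _).
  rewrite mulrA; congr (_ * _); last first.
    by apply: eq_bigl => G; rewrite finset.subsetD1 andbAC.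
  have h := mul_bin_down #|U| M.
  have a0 : ('C(#|U|, M)%:R : R) != 0 by rewrite pnatr_eq0 -lt0n bin_gt0 ltnW.
  have b0 : ('C(#|U|.-1, M)%:R : R) != 0 by rewrite pnatr_eq0 -lt0n bin_gt0; lia.
  have c0 : (#|U|%:R : R) != 0 by rewrite pnatr_eq0; lia.
  have := congr1 (fun x => x%:R : R) h; rewrite !natrM natrB ?(ltnW MU) // => h'.
  apply/eqP; rewrite -(inj_eq (mulfI a0)) divff //; apply/eqP.
  have -> : 'C(#|U|, M)%:R * ((1 - M%:R / #|U|%:R) / 'C(#|U|.-1, M)%:R) =
    ((#|U|%:R - M%:R) * 'C(#|U|, M)%:R) / (#|U|%:R * 'C(#|U|.-1, M)%:R) :> R.
    by field; rewrite b0 c0.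
  by rewrite -h' divff // mulf_neq0.
rewrite mulrA; congr (_ * _); last first.
  rewrite (reindex_onto (fun G => e |: G) (fun G => G :\ e)) /=; last first.
    by move=> G /andP[_ eG]; rewrite finset.setD1K.
  apply: eq_bigl => G; rewrite finset.subsetD1 finset.subUset finset.sub1set eU.
  rewrite finset.setU11 andbT /=.
  case eG : (e \in G) => /=; last first.
    by rewrite cardsU1 eG finset.setU1K ?eG // eqxx !andbT; congr (_ && _); apply/eqP/eqP; lia.
  rewrite !andbF /=; apply/negbTE; rewrite negb_and; apply/orP; right.
  by apply/eqP => /setP/(_ e); rewrite !finset.inE eqxx eG.
have h := mul_bin_diag #|U| M.-1.
rewrite (prednK M0) in h.
have a0 : ('C(#|U|, M)%:R : R) != 0 by rewrite pnatr_eq0 -lt0n bin_gt0 ltnW.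
have b0 : ('C(#|U|.-1, M.-1)%:R : R) != 0 by rewrite pnatr_eq0 -lt0n bin_gt0; lia.
have c0 : (#|U|%:R : R) != 0 by rewrite pnatr_eq0; lia.
have := congr1 (fun x => x%:R : R) h; rewrite !natrM => h'.
apply/eqP; rewrite -(inj_eq (mulfI a0)) divff //; apply/eqP.
have -> : 'C(#|U|, M)%:R * (M%:R / #|U|%:R / 'C(#|U|.-1, M.-1)%:R) =
  (M%:R * 'C(#|U|, M)%:R) / (#|U|%:R * 'C(#|U|.-1, M.-1)%:R) :> R.
  by field; rewrite b0 c0.
by rewrite -h' divff // mulf_neq0.
Qed.

(* The stars at [v] and [w] share one edge. Conditioned on that edge, the two
   degrees are negatively correlated; when it is present (probability
   [m / 'C(n, 2)]) the conditional mean of [g] is bounded through the planted law. *)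
Lemma degrees_mean_le (n m k : nat) (v w : 'I_n) (g : nat -> R) :
  (k <= n.-1)%N -> (k <= m)%N -> (0 < m)%N -> (m < 'C(n, 2))%N -> v != w ->
  {homo g : a b / (a <= b)%N >-> a <= b} ->
  (forall d, 0 <= g d <= ell R n m k d) ->
  draws_mean (edges n) m (fun G => g #|G :&: star v| * g #|G :&: star w|) <=
  hyp_mean n.-1 ('C(n, 2) - n.-1) m g ^+ 2 / (1 - m%:R / 'C(n, 2)%:R) +
  (hyp_mean (n.-1 - k) ('C(n, 2) - n.-1) (m - k) (fun j => (k + j)%:R) / n.-1%:R) ^+ 2 /
    (m%:R / 'C(n, 2)%:R).
Proof.
move=> kn km m0 mN vw hg hge.
have n2 : (1 < n)%N.
  by case: (n) v w vw => [[]//|[|//]] v w; rewrite (ord1 v) (ord1 w) eqxx.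
have nN := leq_pred_bin2 n.
have s1 : (n.-2 + ('C(n, 2) - n.-1) = ('C(n, 2)).-1)%N by clear -n2 nN; lia.
have s2 : (n.-1 + ('C(n, 2) - n.-1) = 'C(n, 2))%N by clear -nN; lia.
have s3 : (('C(n, 2)).-1 - n.-2 = 'C(n, 2) - n.-1)%N by clear -n2 nN; lia.
have s4 : (m <= ('C(n, 2)).-1)%N by clear -mN; lia.
have s5 : (0 < n.-1)%N by clear -n2; lia.
have s6 : (m.-1 <= ('C(n, 2)).-1)%N by clear -s4; lia.
have s7 : (0 < 'C(n, 2))%N by clear -mN; lia.
set p : R := m%:R / _.
set gbar := hyp_mean _ _ m g; set Mom := hyp_mean _ _ _ (fun j => _).
set e := [set v; w]; set U := edges n :\ e.
have ev : e \in star v by exact: set2_star.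
have ew : e \in star w by rewrite /e finset.setUC set2_star // eq_sym.
have eE : e \in edges n by exact: (fintype.subsetP (starS v)).
have cE := card_edges n.
pose A (u : 'I_n) := star u :\ e.
have cA u : e \in star u -> #|A u| = n.-2.
  by move=> eu; have := cardsD1 e (star u); rewrite eu card_star /A => ->.
have sA u : A u \subset U by rewrite finset.setSD // starS.
have cU : #|U| = ('C(n, 2)).-1 by have := cardsD1 e (edges n); rewrite eE cE => ->.
have cUA u : e \in star u -> #|U :\: A u| = ('C(n, 2) - n.-1)%N.
  by move=> eu; rewrite cardsD (finset.setIidPr (sA u)) cU (cA u eu); lia.
have dA : [disjoint A v & A w].
  rewrite -setI_eq0; apply/eqP/setP => x; have /setP/(_ x) := starI vw.
  by rewrite !finset.inE; case: (x == e); case: (x \in star v); case: (x \in star w).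
have GA (G : {set {set 'I_n}}) u : G \subset U -> G :&: star u = G :&: A u.
  rewrite finset.subsetD1 => /andP[_ eG]; apply/setP => x; rewrite !finset.in_setI finset.in_setD1.
  by case: (x =P e) => // ->; rewrite (negbTE eG).
have GA1 (G : {set {set 'I_n}}) u : e \in star u -> G \subset U -> #|(e |: G) :&: star u| = #|G :&: A u|.+1.
  move=> eu GU; have eG : e \notin G by move: GU; rewrite finset.subsetD1 => /andP[].
  have -> : (e |: G) :&: star u = e |: (G :&: A u).
    apply/setP => x; rewrite !(finset.in_setI, finset.in_setU1, finset.in_setD1).
    by case: (x =P e) => [->|].
  by rewrite cardsU1 finset.in_setI finset.in_setD1 eqxx andbF.
have m1 : (m <= #|U|)%N by rewrite cU.
have m2 : (m.-1 <= #|U|)%N by rewrite cU.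
have N0 : (0 < 'C(n, 2)%:R :> R) by rewrite ltr0n.
have p0 : 0 < p by rewrite divr_gt0 // ltr0n.
have p1 : 0 < 1 - p by rewrite subr_gt0 ltr_pdivrMr // mul1r ltr_nat.
(* Conditional means of [g] at one degree when the shared edge is absent ([g0]) or present ([g1]);
   its presence adds 1 to both degrees. *)
pose g0 := hyp_mean n.-2 ('C(n, 2) - n.-1) m g.
pose g1 := hyp_mean n.-2 ('C(n, 2) - n.-1) m.-1 (fun d => g d.+1).
have pgg u : e \in star u -> draws_mean U m (fun G => g #|G :&: A u|) = g0.
  by move=> eu; rewrite draws_mean_count // cA // cUA.
have pgg1 u : e \in star u -> draws_mean U m.-1 (fun G => g #|G :&: A u|.+1) = g1.
  by move=> eu; rewrite (draws_mean_count _ (fun d => g d.+1)) // cA // cUA.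
have gbarE : gbar = (1 - p) * g0 + p * g1.
  rewrite /gbar -(degree_mean _ v g) (draws_mean_split1 _ eE) ?cE // -/p -/U.
  rewrite -(pgg v ev) -(pgg1 v ev); congr (_ * _ + _ * _).
    by apply: eq_draws_mean => G GU; rewrite GA.
  by apply: eq_draws_mean => G GU; rewrite GA1.
have le1 : draws_mean (edges n) m (fun G => g #|G :&: star v| * g #|G :&: star w|) <=
    (1 - p) * (g0 * g0) + p * (g1 * g1).
  rewrite (draws_mean_split1 _ eE) ?cE // -/p -/U; apply: lerD.
    rewrite ler_pM2l // -{1}(pgg v ev) -(pgg w ew).
    apply: le_trans (draws_mean_neg_corr m1 (sA v) (sA w) dA hg hg).
    by apply: ler_draws_mean => G GU; rewrite (GA G v GU) (GA G w GU).
  rewrite ler_pM2l // -{1}(pgg1 v ev) -(pgg1 w ew).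
  have hgS : {homo (fun d => g d.+1) : a b / (a <= b)%N >-> a <= b} by move=> a b ab; apply: hg.
  apply: le_trans (draws_mean_neg_corr m2 (sA v) (sA w) dA hgS hgS).
  by apply: ler_draws_mean => G GU; rewrite (GA1 G v ev GU) (GA1 G w ew GU).
have g0_ge : 0 <= g0.
  rewrite -(@hyp_mean_const R n.-2 ('C(n, 2) - n.-1) m 0) ?s1 ?ler_hyp_mean //.
  by move=> j _; case/andP: (hge j).
have g1_ge : 0 <= g1.
  rewrite -(@hyp_mean_const R n.-2 ('C(n, 2) - n.-1) m.-1 0) ?s1 ?ler_hyp_mean //.
  by move=> j _; case/andP: (hge j.+1).
have K0 : 0 < n.-1%:R :> R by rewrite ltr0n.
(* Since [g <= ell], it suffices to bound [p] times the mean of [ell] at [d + 1]. Size bias by a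
   single element turns this into the null mean of [d * ell d] over [n - 1], and tilting turns that
   into the mean hub degree over [n - 1]. *)
have le2 : p * g1 <= Mom / n.-1%:R.
  rewrite ler_pdivlMr //.
  have -> : Mom = n.-1%:R * (p * hyp_mean n.-2 ('C(n, 2) - n.-1) m.-1 (fun d => ell R n m k d.+1)).
    rewrite /Mom -(@ell_mean R n m k kn km (ltnW mN) (fun d => d%:R)).
    rewrite (eq_hyp_mean _ _ _ (G := fun d => 'C(d, 1)%:R * ell R n m k d)); last first.
      by move=> d; rewrite bin1 mulrC.
    rewrite hyp_mean_size_bias ?s2 // ?(ltnW mN) // bin1 mulrA !subn1 s1.
    congr (_ * _); rewrite -mulrA; congr (_ * _); rewrite /p.
    have h := mul_bin_diag 'C(n, 2) m.-1; rewrite (prednK m0) in h.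
    have := congr1 (fun x => x%:R : R) h; rewrite !natrM => h'.
    have a0 : ('C('C(n, 2), m)%:R : R) != 0 by rewrite pnatr_eq0 -lt0n bin_gt0 ltnW.
    apply/eqP; rewrite eqr_div //; last by rewrite gt_eqF.
    by apply/eqP; rewrite mulrC h'.
  rewrite mulrC ler_pM2l // ler_pM2l //; apply: ler_hyp_mean => j _.
  by case/andP: (hge j.+1).
have q0 : 0 <= (1 - p) * g0 by rewrite mulr_ge0 // ltW.
have q1 : 0 <= p * g1 by rewrite mulr_ge0 // ltW.
(* Each term is rewritten as a square over its probability: [(1 - p) * g0] is at most [gbar], and
   [p * g1] is bounded by [le2]. *)
apply: le_trans le1 _; apply: lerD; rewrite ler_pdivlMr //.
  have -> : (1 - p) * (g0 * g0) * (1 - p) = ((1 - p) * g0) ^+ 2 by ring.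
  apply: lerXn2r; rewrite ?nnegrE ?gbarE ?addr_ge0 //.
  by rewrite lerDl.
have -> : p * (g1 * g1) * p = (p * g1) ^+ 2 by ring.
by apply: lerXn2r; rewrite ?nnegrE // (le_trans q1).
Qed.

End Bounds.

Section TotalVariation.
Variables (R : realType) (T : finType) (P Q : T -> R).

Lemma TV_ge_event (A : pred T) : \sum_x P x = \sum_x Q x ->
  \sum_(x | A x) P x - \sum_(x | A x) Q x <= TV P Q.
Proof.
move=> PQ; rewrite /TV.
have h1 : \sum_(x | A x) P x - \sum_(x | A x) Q x <= \sum_(x | A x) `|P x - Q x|.
  by rewrite -sumrB; apply: ler_sum => x _; apply: ler_norm.
have h2 : \sum_(x | ~~ A x) Q x - \sum_(x | ~~ A x) P x <= \sum_(x | ~~ A x) `|P x - Q x|.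
  by rewrite -sumrB; apply: ler_sum => x _; rewrite distrC; apply: ler_norm.
have spl (F : T -> R) : \sum_x F x = \sum_(x | A x) F x + \sum_(x | ~~ A x) F x.
  exact: bigID.
move: PQ h1 h2; rewrite (spl P) (spl Q) (spl (fun x => `|P x - Q x|)).
do 6 move: (\sum_(x | _) _) => ?; lra.
Qed.

(** Only points where the likelihood ratio is below 1 count, so replacing the ratio by something
    smaller, such as a truncation, still bounds TV from above. *)
Lemma TV_pos_part : \sum_x P x = \sum_x Q x -> TV P Q = \sum_x Num.max 0 (Q x - P x).
Proof.
move=> PQ; rewrite /TV.
have -> : \sum_x `|P x - Q x| = \sum_x (2 * Num.max 0 (Q x - P x) + (P x - Q x)).
  apply: eq_bigr => x _; rewrite distrC.
  case: (lerP 0 (Q x - P x)) => h; [rewrite ger0_norm // | rewrite ltr0_norm //]; ring.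
rewrite big_split -mulr_sumr sumrB /= PQ; lra.
Qed.

End TotalVariation.

(** * Reduction of total variation to the planted tail *)

Section Reduction.
Variables (R : realType) (n m k : nat).
Hypotheses (n1 : (1 < n)%N) (kn : (k <= n.-1)%N) (km : (k <= m)%N)
  (m0 : (0 < m)%N) (mN : (m < 'C(n, 2))%N).

Let l := ell R n m k.
Let L0 := ('C(n, 2) - n.-1)%N.

(** The planted probability that the likelihood ratio at the hub exceeds [c], called [Q(c)] in the
    overview. *)
Definition tail_mass (c : R) : R :=
  hyp_mean (n.-1 - k) L0 (m - k) (fun j => (c < l (k + j)%N)%R%:R).

Let E0 (F : {set {set 'I_n}} -> R) := draws_mean (edges n) m F.
Let mE : (m <= #|edges n|)%N. Proof. by rewrite card_edges ltnW. Qed.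
Let n0 : 0 < n%:R :> R. Proof. by rewrite ltr0n; lia. Qed.

Let L0K : (m <= n.-1 + L0)%N.
Proof. by rewrite /L0 subnKC ?leq_pred_bin2 // ltnW. Qed.

Let L0Kk : (m - k <= n.-1 - k + L0)%N.
Proof. by have := leq_pred_bin2 n; rewrite /L0; lia. Qed.

Let P1_mean (F : {set {set 'I_n}} -> R) : \sum_G P1 R m k G * F G =
  E0 (fun G => n%:R^-1 * \sum_(v : 'I_n) l #|G :&: star v| * F G).
Proof.
rewrite /E0 -P0_mean; apply: eq_bigr => G _.
by rewrite P1_density ?(ltnW mN) // -mulrA -mulrA mulr_suml.
Qed.

Let ell_hyp_mean : hyp_mean n.-1 L0 m l = 1.
Proof.
rewrite (eq_hyp_mean _ _ _ (G := fun d => l d * 1)); last by move=> d; rewrite mulr1.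
by rewrite ell_mean ?(ltnW mN) // hyp_mean_const.
Qed.

Let ell_mean1 v : E0 (fun G => l #|G :&: star v|) = 1.
Proof.
by rewrite /E0 degree_mean ell_hyp_mean.
Qed.

Let sumP0 : \sum_(G : {set {set 'I_n}}) P0 R m G = 1 :> R.
Proof.
rewrite (eq_bigr (fun G => P0 R m G * 1)); last by move=> G _; rewrite mulr1.
by rewrite P0_mean draws_mean_const.
Qed.

Let sumP1 : \sum_(G : {set {set 'I_n}}) P1 R m k G = 1 :> R.
Proof.
rewrite (eq_bigr (fun G => P1 R m k G * 1)); last by move=> G _; rewrite mulr1.
rewrite P1_mean /E0 draws_meanZ draws_mean_sum.
rewrite (eq_bigr (fun=> 1)); last first.
  move=> v _; rewrite -[RHS](ell_mean1 v); apply: eq_draws_mean => G _; exact: mulr1.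
by rewrite sumr_const card_ord mulVf // gt_eqF.
Qed.

(* The test rejecting when some vertex has likelihood ratio above [C n]. *)
Lemma TV_ge_tail_mass (C : R) : 0 < C ->
  tail_mass (C * n%:R) - C^-1 <= TV (@P1 R n m k) (@P0 R n m).
Proof.
move=> C0; pose A (G : {set {set 'I_n}}) := [exists v : 'I_n, C * n%:R < l #|G :&: star v|].
have := @TV_ge_event R _ (@P1 R n m k) (@P0 R n m) A; rewrite sumP0 sumP1 => /(_ erefl).
apply: le_trans; apply: lerB.
  have -> : \sum_(G | A G) P1 R m k G = \sum_G P1 R m k G * (A G)%:R.
    by rewrite big_mkcond; apply: eq_bigr => G _; case: (A G); rewrite ?mulr1 ?mulr0.
  rewrite P1_mean /E0 draws_meanZ draws_mean_sum.
  rewrite -[leLHS](mulKf (lt0r_neq0 n0)) ler_pM2l ?invr_gt0 //.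
  have -> : n%:R * tail_mass (C * n%:R) = \sum_(v : 'I_n) tail_mass (C * n%:R).
    by rewrite sumr_const card_ord mulr_natl.
  (* For each hub [v], the event [A] is replaced by the smaller event that [v] itself passes the
     threshold. *)
  apply: ler_sum => v _; rewrite /tail_mass.
  rewrite -(@ell_mean R n m k kn km (ltnW mN) (fun d => (C * n%:R < l d)%R%:R)).
  rewrite -(degree_mean _ v (fun d => l d * (C * n%:R < l d)%R%:R)).
  apply: ler_draws_mean => G _; rewrite ler_wpM2l ?ell_ge0 // ler_nat.
  case h : (_ < _) => //=; rewrite /A (_ : [exists _, _] = true) //.
  by apply/existsP; exists v.
have -> : \sum_(G | A G) P0 R m G = \sum_G P0 R m G * (A G)%:R.
  by rewrite big_mkcond; apply: eq_bigr => G _; case: (A G); rewrite ?mulr1 ?mulr0.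
rewrite P0_mean.
(* Union bound and Markov at once: the indicator of [A] is at most the sum over the [n] vertices of
   [l / (C * n)], each term having mean [1 / (C * n)]. *)
apply: le_trans (_ : E0 (fun G => \sum_(v : 'I_n) (C * n%:R)^-1 * l #|G :&: star v|) <= _).
  apply: ler_draws_mean => G _; rewrite /A; case: existsP => [[v hv]|_]; last first.
    by apply: sumr_ge0 => v _; rewrite mulr_ge0 ?ell_ge0 // invr_ge0 mulr_ge0 // ltW.
  rewrite (bigD1 v) //= -[leLHS]addr0; apply: lerD.
    by rewrite ler_pdivlMl ?mulr1 ?ltW // mulr_gt0.
  by apply: sumr_ge0 => w _; rewrite mulr_ge0 ?ell_ge0 // invr_ge0 mulr_ge0 // ltW.
rewrite /E0 draws_mean_sum (eq_bigr (fun=> (C * n%:R)^-1)); last first.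
  by move=> v _; rewrite draws_meanZ -/(E0 _) ell_mean1 mulr1.
rewrite sumr_const card_ord -[X in X <= _]mulr_natr invfM -mulrA mulVf ?mulr1 //.
by rewrite gt_eqF.
Qed.

(* Chebyshev's inequality for the likelihood ratio truncated at [eps * n]. *)
Lemma TV_le_tail_mass (eps delta : R) : 0 < eps -> 0 < delta ->
  let p : R := m%:R / 'C(n, 2)%:R in
  let X : R := (hyp_mean (n.-1 - k) L0 (m - k) (fun j => (k + j)%:R) / n.-1%:R) ^+ 2 / p in
  TV (@P1 R n m k) (@P0 R n m) <=
  tail_mass (eps * n%:R) + delta + (eps + p / (1 - p) + X) / delta.
Proof.
move=> e0 d0; cbv zeta; set p : R := m%:R / 'C(n, 2)%:R; set X := _ ^+ 2 / p.
pose g d := Num.min (l d) (eps * n%:R).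
have en0 : 0 < eps * n%:R by rewrite mulr_gt0.
have gh : {homo g : a b / (a <= b)%N >-> a <= b}.
  move=> a b ab; have := @ell_homo R n m k a b ab; rewrite /g -/l => h.
  by rewrite le_min !ge_min lexx h orbT.
have gE d : 0 <= g d <= l d by rewrite /g le_min ge_min ell_ge0 ltW //= lexx.
pose gbar := hyp_mean n.-1 L0 m g.
have gm v : E0 (fun G => g #|G :&: star v|) = gbar by rewrite /E0 degree_mean.
have gbar_ge0 : 0 <= gbar.
  rewrite -(@hyp_mean_const R n.-1 L0 m 0) //; apply: ler_hyp_mean => j _.
  by case/andP: (gE j).
have gbar_le1 : gbar <= 1.
  by rewrite -ell_hyp_mean; apply: ler_hyp_mean => j _; case/andP: (gE j).
(* The truncation dominates [l] restricted to [l <= eps * n], whose mean after tilting is one minus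
   the tail. *)
have gbar_ge : 1 - tail_mass (eps * n%:R) <= gbar.
  have -> : 1 - tail_mass (eps * n%:R) =
      hyp_mean n.-1 L0 m (fun d => l d * (1 + -1 * (eps * n%:R < l d)%R%:R)).
    rewrite (@ell_mean R n m k kn km (ltnW mN) (fun d => 1 + -1 * (eps * n%:R < l d)%R%:R)).
    by rewrite hyp_meanD hyp_meanZ hyp_mean_const // mulN1r.
  apply: ler_hyp_mean => d _; rewrite /g le_min.
  case: ltP => h; rewrite /= ?mulr1 ?mulr0 ?addr0 ?subrr ?mulr0 ?mulr1 ?lexx //=.
  by rewrite ell_ge0 ltW.
pose A (G : {set {set 'I_n}}) := n%:R^-1 * \sum_(v : 'I_n) g #|G :&: star v|.
have EA : E0 A = gbar.
  rewrite /E0 /A draws_meanZ draws_mean_sum (eq_bigr (fun=> gbar)); last by move=> v _; exact: gm.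
  by rewrite sumr_const card_ord -[X in _ * X]mulr_natl mulKf // gt_eqF.
have N0 : (0 < 'C(n, 2)%:R :> R) by rewrite ltr0n (leq_trans _ mN).
have p0 : 0 < p by rewrite divr_gt0 // ltr0n.
have p1 : 0 < 1 - p by rewrite subr_gt0 ltr_pdivrMr // mul1r ltr_nat.
have X0 : 0 <= X by rewrite divr_ge0 ?sqr_ge0 // ltW.
pose B := gbar ^+ 2 / (1 - p) + X.
have B0 : 0 <= B by rewrite addr_ge0 // divr_ge0 ?sqr_ge0 // ltW.
(* The diagonal uses [g ^+ 2 <= eps * n * g] and [gbar <= 1], which costs [eps] in total; every
   off-diagonal term is at most [B]. *)
have EA2 : E0 (fun G => A G ^+ 2) <= eps + B.
  have -> : E0 (fun G => A G ^+ 2) = n%:R^-1 ^+ 2 * \sum_(v : 'I_n) \sum_(w : 'I_n)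
      E0 (fun G => g #|G :&: star v| * g #|G :&: star w|).
    rewrite -(eq_bigr _ (fun v _ => draws_mean_sum _ _ _ _)) -draws_mean_sum -draws_meanZ.
    apply: eq_draws_mean => G _; rewrite /A exprMn; congr (_ * _).
    rewrite expr2 mulr_suml; apply: eq_bigr => v _; by rewrite mulr_sumr.
  rewrite exprVn ler_pdivrMl ?exprn_gt0 //.
  have -> : n%:R ^+ 2 * (eps + B) = \sum_(v : 'I_n) (eps * n%:R + \sum_(w : 'I_n) B).
    have sumc (c : R) : \sum_(v : 'I_n) c = n%:R * c by rewrite sumr_const card_ord mulr_natl.
    by rewrite !sumc; ring.
  apply: ler_sum => v _; rewrite (bigD1 v) //=; apply: lerD.
    apply: le_trans (_ : E0 (fun G => eps * n%:R * g #|G :&: star v|) <= _).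
      apply: ler_draws_mean => G _; apply: ler_wpM2r; first by case/andP: (gE #|G :&: star v|).
      by rewrite /g ge_min lexx orbT.
    by rewrite /E0 draws_meanZ -/(E0 _) gm ler_piMr // ltW.
  rewrite [leRHS](bigD1 v) //= -[leLHS]add0r; apply: lerD => //.
  by apply: ler_sum => w wv; apply: degrees_mean_le => //; rewrite eq_sym.
have VA : E0 (fun G => (A G - gbar) ^+ 2) <= eps + p / (1 - p) + X.
  have -> : E0 (fun G => (A G - gbar) ^+ 2) = E0 (fun G => A G ^+ 2) - gbar ^+ 2.
    have -> : E0 (fun G => (A G - gbar) ^+ 2) =
        E0 (fun G => A G ^+ 2 + ((- 2 * gbar) * A G + gbar ^+ 2)).
      by apply: eq_draws_mean => G _; ring.
    by rewrite /E0 !draws_meanD draws_meanZ draws_mean_const // -!/(E0 _) EA; ring.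
  have g2 : gbar ^+ 2 <= 1 by rewrite expr_le1.
  have : gbar ^+ 2 * (p / (1 - p)) <= 1 * (p / (1 - p)).
    by rewrite ler_wpM2r // divr_ge0 // ltW.
  have -> : gbar ^+ 2 * (p / (1 - p)) = gbar ^+ 2 / (1 - p) - gbar ^+ 2.
    by field; rewrite gt_eqF.
  by move: EA2; rewrite /B mul1r; lra.
rewrite TV_pos_part ?sumP0 ?sumP1 //.
have -> : \sum_(G : {set {set 'I_n}}) Num.max 0 (P0 R m G - P1 R m k G) = \sum_(G : {set {set 'I_n}}) P0 R m G *
    Num.max 0 (1 - n%:R^-1 * \sum_(v : 'I_n) l #|G :&: star v|).
  apply: eq_bigr => G _; rewrite P1_density ?(ltnW mN) // maxr_pMr ?mulr0 ?mulrBr ?mulr1 //.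
  by rewrite /P0 /unif_subsets; case: ifP.
rewrite P0_mean.
(* Pointwise form of Chebyshev: [A G] lies below the likelihood ratio, and completing a square gives
   [gbar - A G <= delta + (A G - gbar)^2 / delta], so only the variance of [A] is needed. *)
apply: le_trans (_ : E0 (fun G => (1 - gbar + delta) + delta^-1 * (A G - gbar) ^+ 2) <= _).
  apply: ler_draws_mean => G _.
  have hA : A G <= n%:R^-1 * \sum_(v : 'I_n) l #|G :&: star v|.
    rewrite /A ler_pM2l ?invr_gt0 //; apply: ler_sum => v _.
    by case/andP: (gE #|G :&: star v|).
  have hy : gbar - A G <= delta + delta^-1 * (A G - gbar) ^+ 2.
    have : 0 <= delta^-1 * ((A G - gbar) + delta / 2) ^+ 2.
      by rewrite mulr_ge0 ?sqr_ge0 // invr_ge0 ltW.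
    have -> : delta^-1 * ((A G - gbar) + delta / 2) ^+ 2 =
      delta^-1 * (A G - gbar) ^+ 2 + (A G - gbar) + delta / 4 by field; rewrite gt_eqF.
    by move: d0; lra.
  have hz : 0 <= delta^-1 * (A G - gbar) ^+ 2 by rewrite mulr_ge0 ?sqr_ge0 // invr_ge0 ltW.
  by rewrite ge_max; apply/andP; split; lra.
rewrite /E0 draws_meanD draws_meanZ draws_mean_const // -/(E0 _) [delta^-1 * _]mulrC.
apply: lerD; first by rewrite lerD2r; lra.
by rewrite ler_pM2r // invr_gt0.
Qed.

End Reduction.

(** * The Gaussian distribution function *)

Section LnBounds.
Variable R : realType.
Implicit Type v : R.

Lemma ln1D_le v : -1 < v -> ln (1 + v) <= v.
Proof.
move=> v1; have v0 : 0 < 1 + v by rewrite -ltrBlDl sub0r.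
by rewrite -[leRHS]expRK ler_ln ?posrE ?expR_gt0 ?expR_ge1Dx.
Qed.

(** Apply the upper bound to the reciprocal [1 / (1 + v) = 1 - v / (1 + v)]; for [v >= -1/2] the
    quotient [v / (1 + v)] is at least [v - 2 v^2]. *)
Lemma ln1D_ge v : - 2^-1 <= v -> v - 2 * v ^+ 2 <= ln (1 + v).
Proof.
move=> v1; have v0 : 0 < 1 + v by lra.
have : ln (1 + (- (v / (1 + v)))) <= - (v / (1 + v)).
  apply: ln1D_le; rewrite ltrN2 ltr_pdivrMr // mul1r; lra.
have -> : 1 + - (v / (1 + v)) = (1 + v)^-1 by field; rewrite gt_eqF.
rewrite lnV ?posrE // lerN2; apply: le_trans.
rewrite ler_pdivlMr //.
have -> : (v - 2 * v ^+ 2) * (1 + v) = v - v ^+ 2 * (1 + 2 * v) by ring.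
by rewrite gerBl mulr_ge0 ?sqr_ge0 //; lra.
Qed.

Lemma ln1D_approx v : `|v| <= 2^-1 -> `|ln (1 + v) - v| <= 2 * v ^+ 2.
Proof.
rewrite ler_norml => /andP[v1 v2].
have h1 := ln1D_ge v1; have h2 : ln (1 + v) <= v by apply: ln1D_le; lra.
have := sqr_ge0 v => h3; rewrite ler_norml; apply/andP; split; lra.
Qed.

Lemma norm_ln1D v : `|v| <= 2^-1 -> `|ln (1 + v)| <= 2 * `|v|.
Proof.
move=> hv; have h := ln1D_approx hv.
have -> : ln (1 + v) = (ln (1 + v) - v) + v by ring.
apply: le_trans (ler_normD _ _) _; apply: le_trans (lerD h (lexx _)) _.
have : `|v| * `|v| <= 2^-1 * `|v| by rewrite ler_wpM2r.
by rewrite -[v ^+ 2]real_normK ?num_real // expr2; lra.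
Qed.

End LnBounds.

Local Open Scope classical_set_scope.

Section PhiFacts.
Variable R : realType.
Implicit Types x y : R.

Let mu := @lebesgue_measure R.
Let phi x : R := normal_pdf 0 1 x.

Lemma normal_pdf01E x : normal_pdf 0 1 x = normal_peak 1 * expR (- (x ^+ 2 / 2)).
Proof. by rewrite normal_pdfE // /normal_fun subr0 expr1n mulr2n mulNr. Qed.

Lemma Phi_derive x : derivable (@Phi R) x 1 /\ (@Phi R)^`() x = normal_pdf 0 1 x.
Proof.
have := @continuous_FTC1 R phi -oo%O x (x + 1).
rewrite ltrDl ltr01 => /(_ isT); apply.
- apply: (integrableS measurableT) => //; exact: integrable_normal_pdf.
- by rewrite ltNyr.
- exact: continuous_normal_pdf.
Qed.

Lemma Phi_continuous : continuous (@Phi R).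
Proof.
by move=> x; apply: differentiable_continuous; apply/derivable1_diffP; case: (Phi_derive x).
Qed.

(** The identity viewed as a random variable under the standard normal law: its distribution
    function is [Phi], which gives monotonicity and the limits at infinity. *)
Let idR : measurableTypeR R -> R := idfun.

#[local] HB.instance Definition _ :=
  @isMeasurableFun.Build _ _ _ _ idR (@measurable_id _ _ setT).

Let Y : {RV (@normal_prob R 0 1) >-> R} := idR.

Let cdfY x : cdf Y x = normal_prob 0 1 `]-oo, x].
Proof. by []. Qed.

Let PhiK x : (Phi x)%:E = cdf Y x.
Proof. by rewrite /Phi -cdfY fineK // fin_num_measure. Qed.

Lemma Phi_ge0 x : 0 <= Phi x.
Proof. by rewrite -lee_fin PhiK. Qed.

Lemma Phi_le1 x : Phi x <= 1.
Proof. by rewrite -lee_fin PhiK; exact: probability_le1. Qed.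

Lemma Phi_nondecreasing x y : x <= y -> Phi x <= Phi y.
Proof. by move=> xy; rewrite -lee_fin !PhiK cdf_nondecreasing. Qed.

Lemma Phi_cvgy : @Phi R x @[x --> +oo] --> (1 : R).
Proof.
have /fine_cvgP[_] := cvg_cdfy1 Y.
by rewrite (_ : _ \o _ = @Phi R) //; apply/funext => x /=; rewrite -PhiK.
Qed.

Lemma Phi_cvgNy : @Phi R x @[x --> -oo] --> (0 : R).
Proof.
have /fine_cvgP[_] := cvg_cdfNy0 Y.
by rewrite (_ : _ \o _ = @Phi R) //; apply/funext => x /=; rewrite -PhiK.
Qed.

Lemma Phi_mvt x y : x < y ->
  exists2 z, x < z < y & Phi y - Phi x = normal_pdf 0 1 z * (y - x).
Proof.
move=> xy; have [||z + ->] := @MVT R (@Phi R) (fun x => normal_pdf 0 1 x) x y xy.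
- move=> t _; have [h1 h2] := Phi_derive t.
  by rewrite -h2 derive1E; apply: derivableP.
- by apply: continuous_subspaceT => t; exact: Phi_continuous.
by rewrite in_itv /= => hz; exists z.
Qed.

End PhiFacts.

(** * Central limit theorem for the hypergeometric law *)

(* A probability [p] on [0..K] whose log-increments on the window
   [|j - mu| <= r * s] are close to those of the Gaussian density is compared,
   on that window, with the Gaussian masses of the cells
   [((j - mu) / s, (j + 1 - mu) / s]]; the rest of the mass is controlled by
   Chebyshev's inequality. *)
Section LocalLimit.
Variables (R : realType) (p : nat -> R) (K : nat) (mu s r kappa : R).
Hypotheses (kappa_ge0 : 0 <= kappa) (s1 : 1 <= s) (s2 : s ^+ 2 = mu) (r1 : 1 <= r) (rs : r * s <= mu)
  (rK : mu + r * s < K%:R) (p_ge0 : forall j, 0 <= p j)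
  (sum_p : \sum_(0 <= j < K.+1) p j = 1)
  (var_p : \sum_(0 <= j < K.+1) p j * (j%:R - mu) ^+ 2 <= mu)
  (p_gt0 : forall j, `|j%:R - mu| <= r * s -> 0 < p j)
  (p_step : forall j, `|j%:R - mu| <= r * s -> `|j.+1%:R - mu| <= r * s ->
     `|ln (p j.+1) - ln (p j) + (j%:R - mu) / mu| <= kappa).

Let x (j : nat) : R := (j%:R - mu) / s.
Let q j : R := Phi (x j.+1) - Phi (x j).
Let h : R := s^-1.
(** Rounding convention: [a <= j < b] says that [j] lies in [(mu - r s, mu + r s]], and [j < c z]
    says [j <= mu + z s]. *)
Let a := (Num.truncn (mu - r * s)).+1.
Let b := (Num.truncn (mu + r * s)).+1.
Let c z := (Num.truncn (mu + z * s)).+1.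
(** In the exponent, [2 r s kappa + r h] bounds the oscillation of [u] (below) over the window and
    [(2 r + 1) h] is twice the error in [ln (q j)]. *)
Let E : R := expR (2 * r * s * kappa + (3 * r + 1) * h).

Let s0 : 0 < s. Proof. exact: lt_le_trans s1. Qed.
Let r0 : 0 < r. Proof. exact: lt_le_trans r1. Qed.
Let rs0 : 0 < r * s. Proof. exact: mulr_gt0. Qed.
Let mu0 : 0 < mu. Proof. exact: lt_le_trans rs. Qed.
Let h0 : 0 < h. Proof. by rewrite /h invr_gt0. Qed.
Let h1 : h <= 1. Proof. by rewrite /h invf_le1. Qed.
Let sh : s * h = 1. Proof. by rewrite /h divff // gt_eqF. Qed.

Let xS j : x j.+1 = x j + h.
Proof. by rewrite /x /h -natr1; field; rewrite gt_eqF. Qed.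

Let win j : ((a <= j) && (j < b))%N -> `|j%:R - mu| <= r * s.
Proof.
rewrite /a /b ltnS => /andP[ja jb].
have t1 : 0 <= mu - r * s by rewrite subr_ge0.
have t2 : 0 <= mu + r * s by rewrite addr_ge0 ?ltW.
rewrite (truncn_lt_nat _ t1) in ja; rewrite truncn_ge_nat // in jb.
rewrite ler_norml; apply/andP; split; lra.
Qed.

Let winx j : `|j%:R - mu| <= r * s -> `|x j| <= r.
Proof.
by move=> hj; rewrite /x normrM [`|s^-1|]gtr0_norm ?invr_gt0 // ler_pdivrMr.
Qed.

Let q_ge0 j : 0 <= q j.
Proof. by rewrite subr_ge0; apply: Phi_nondecreasing; rewrite xS lerDl ltW. Qed.

(** The logarithm of [p] relative to the Gaussian density, up to a constant. It varies slowly
    because [s ^+ 2 = mu] makes the Gaussian increment [x j * h] equal to [(j - mu) / mu]. *)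
Let u j := ln (p j) + x j ^+ 2 / 2.

Let u_step j : ((a <= j) && (j.+1 < b))%N -> `|u j.+1 - u j| <= kappa + h ^+ 2 / 2.
Proof.
case/andP=> ja jb; have := p_step (win (j := j) _) (win (j := j.+1) _).
rewrite ja (ltnW jb) (leq_trans ja (leqnSn _)) jb => /(_ isT isT) hs.
have -> : u j.+1 - u j = (ln (p j.+1) - ln (p j) + (j%:R - mu) / mu) + h ^+ 2 / 2.
  rewrite /u xS /x /h -s2.
  by field; rewrite gt_eqF.
apply: le_trans (ler_normD _ _) _; apply: lerD => //.
by rewrite ger0_norm // divr_ge0 ?sqr_ge0.
Qed.

Let u_diff i d : (a <= i)%N -> (i + d < b)%N ->
  `|u (i + d)%N - u i| <= d%:R * (kappa + h ^+ 2 / 2).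
Proof.
move=> ai; elim: d => [|d IH] db; first by rewrite addn0 subrr normr0 mul0r.
have -> : u (i + d.+1)%N - u i = (u (i + d).+1 - u (i + d)%N) + (u (i + d)%N - u i).
  by rewrite addnS; ring.
rewrite addnS in db.
apply: le_trans (ler_normD _ _) _; rewrite -natr1 mulrDl mul1r addrC; apply: lerD.
  by apply: IH; apply: ltnW.
by apply: u_step; rewrite db (leq_trans ai) // leq_addr.
Qed.

Let u_close i j : ((a <= i) && (i < b))%N -> ((a <= j) && (j < b))%N ->
  u i - u j <= 2 * r * s * kappa + r * h.
Proof.
have -> : 2 * r * s * kappa + r * h = 2 * (r * s) * (kappa + h ^+ 2 / 2).
  have e1 : r * h = r * (s * h) * h by rewrite sh mulr1.
  by rewrite e1; field.
suff wl i' d : ((a <= i') && (i' < b))%N -> ((a <= i' + d) && (i' + d < b))%N ->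
    `|u (i' + d)%N - u i'| <= 2 * (r * s) * (kappa + h ^+ 2 / 2).
  move=> hi hj; case: (leqP i j) => ij.
    rewrite -(subnKC ij) in hj *; apply: le_trans (wl _ _ hi hj).
    by rewrite distrC ler_norm.
  rewrite -(subnKC (ltnW ij)) in hi *; apply: le_trans (wl _ _ hj hi).
  exact: ler_norm.
move=> hi hd; case/andP: (hi) => ai _; case/andP: (hd) => _ db.
apply: le_trans (u_diff ai db) _; apply: ler_wpM2r.
  by rewrite addr_ge0 // divr_ge0 ?sqr_ge0.
have := win hi; have := win hd; rewrite natrD !ler_norml => /andP[w1 w2] /andP[w3 w4].
lra.
Qed.

Let lnq_close j : ((a <= j) && (j < b))%N ->
  [/\ 0 < q j & `|ln (q j) + x j ^+ 2 / 2 - ln (normal_peak 1 * h)| <= h * (2 * r + 1) / 2].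
Proof.
move=> hj; have hx := winx (win hj).
have [xi /andP[xi1 xi2] qE] := Phi_mvt (x := x j) (y := x j.+1) ltac:(by rewrite xS ltrDl).
rewrite -/(q j) xS (addrC (x j)) addrK normal_pdf01E in qE.
have pk : 0 < normal_peak 1 * h :> R by rewrite mulr_gt0 // normal_peak_gt0 // oner_eq0.
have qE2 : q j = normal_peak 1 * h * expR (- (xi ^+ 2 / 2)) by rewrite qE; ring.
split; first by rewrite qE2 mulr_gt0 ?expR_gt0.
rewrite qE2 lnM ?posrE ?expR_gt0 // expRK.
have -> : ln (normal_peak 1 * h) - xi ^+ 2 / 2 + x j ^+ 2 / 2 - ln (normal_peak 1 * h) =
  - ((xi - x j) * (xi + x j) / 2) by field.
rewrite xS in xi2; rewrite normrN normrM normrM [`|2^-1|]ger0_norm // ler_wpM2r //.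
apply: ler_pM => //; first by rewrite gtr0_norm ?subr_gt0 // lerBlDl ltW.
move: hx; rewrite !ler_norml => /andP[hx1 hx2]; apply/andP; split; have := h1; have := h0; lra.
Qed.

(** Cross-multiplication keeps both normalising constants out; double sums of this inequality
    compare the shares that [p] and [q] give to a part of the window. *)
Let ratio i j : ((a <= i) && (i < b))%N -> ((a <= j) && (j < b))%N ->
  p i * q j <= E * (p j * q i).
Proof.
move=> hi hj.
have pi0 := p_gt0 (win hi); have pj0 := p_gt0 (win hj).
have [qi0 qi] := lnq_close hi; have [qj0 qj] := lnq_close hj.
rewrite -ler_ln ?posrE ?mulr_gt0 ?expR_gt0 //.
rewrite !lnM ?posrE ?mulr_gt0 ?expR_gt0 // expRK.
have := u_close hi hj; rewrite /u.
have -> : (3 * r + 1) * h = r * h + h * (2 * r + 1) by ring.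
move: qi qj; rewrite !ler_norml => /andP[? ?] /andP[? ?] ?; lra.
Qed.

Let restr (F : nat -> R) m n : (n <= K.+1)%N ->
  \sum_(m <= j < n) F j = \sum_(0 <= j < K.+1) F j * ((m <= j < n)%N)%:R.
Proof.
move=> nK; rewrite (big_nat_widen _ _ _ _ _ nK) (big_nat_widenl _ 0) //.
rewrite big_mkcond /=; apply: eq_big_nat => j _.
by case: (m <= j)%N; case: (j < n)%N; rewrite ?mulr1 ?mulr0.
Qed.

Let bK : (b <= K.+1)%N.
Proof.
rewrite /b ltnS -(ler_nat R); have /truncn_itv/andP[+ _] : 0 <= mu + r * s by rewrite addr_ge0 ?ltW.
by move=> /le_trans; apply; exact: ltW.
Qed.

Let W := \sum_(a <= j < b) p j.

Let W_le1 : W <= 1.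
Proof.
rewrite /W restr // -[leRHS]sum_p; apply: ler_sum => j _.
by apply: ler_piMr => //; case: (_ && _) => /=; [exact: lexx|exact: ler01].
Qed.

Let out_win j : ~~ ((a <= j) && (j < b))%N -> r ^+ 2 * mu <= (j%:R - mu) ^+ 2.
Proof.
move=> hj; have -> : r ^+ 2 * mu = (r * s) ^+ 2 by rewrite exprMn s2.
have t1 : 0 <= mu - r * s by rewrite subr_ge0.
have t2 : 0 <= mu + r * s by rewrite addr_ge0 ?ltW.
move: hj; rewrite negb_and -ltnNge -leqNgt /a /b ltnS => /orP[hj|hj].
  rewrite -(ler_nat R) in hj; case/andP: (truncn_itv t1) => t3 _.
  rewrite -[leRHS]sqrrN; apply: lerXn2r; rewrite ?nnegrE ?(ltW rs0) //; have := rs0; lra.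
rewrite -(ler_nat R) in hj; case/andP: (truncn_itv t2) => _ t3.
apply: lerXn2r; rewrite ?nnegrE ?(ltW rs0) //; have := rs0; lra.
Qed.

Let W_ge : 1 - (r ^+ 2)^-1 <= W.
Proof.
have r2 : 0 < r ^+ 2 by rewrite exprn_gt0.
have : \sum_(0 <= j < K.+1) p j <= \sum_(0 <= j < K.+1)
   (p j * ((a <= j < b)%N)%:R + (r ^+ 2 * mu)^-1 * (p j * (j%:R - mu) ^+ 2)).
  apply: ler_sum => j _; rewrite (mulrCA _^-1) -mulrDr ler_peMr //.
  case hj : (_ && _) => /=; first by rewrite lerDl mulr_ge0 ?sqr_ge0 // invr_ge0 (ltW (mulr_gt0 r2 mu0)).
  by rewrite add0r ler_pdivlMl ?mulr_gt0 // mulr1 out_win // hj.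
rewrite big_split /= -restr // -/W sum_p -mulr_sumr.
have : (r ^+ 2 * mu)^-1 * (\sum_(0 <= j < K.+1) p j * (j%:R - mu) ^+ 2) <= (r ^+ 2)^-1.
  rewrite ler_pdivrMl ?mulr_gt0 //; apply: le_trans var_p _.
  by rewrite mulrAC divff ?mul1r // gt_eqF.
lra.
Qed.

Let sumq m n : (m <= n)%N -> \sum_(m <= j < n) q j = Phi (x n) - Phi (x m).
Proof. by move=> mn; rewrite telescope_sumr. Qed.

Variable z : R.
Hypothesis (rz : `|z| <= r).

Let cdf := \sum_(0 <= j < K.+1) p j * (j%:R <= mu + z * s)%R%:R.

Let zr1 : - r * s <= z * s.
Proof. by rewrite ler_pM2r //; move: rz; rewrite ler_norml => /andP[]. Qed.
Let zr2 : z * s <= r * s.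
Proof. by rewrite ler_pM2r //; move: rz; rewrite ler_norml => /andP[]. Qed.
Let t1 : 0 <= mu - r * s. Proof. by rewrite subr_ge0. Qed.
Let t2 : 0 <= mu + z * s.
Proof. by have := t1; have := zr1; lra. Qed.
Let ac : (a <= c z)%N.
Proof. by rewrite /a /c ltnS le_truncn //; have := zr1; lra. Qed.
Let cb : (c z <= b)%N.
Proof. by rewrite /b /c ltnS le_truncn //; have := zr2; lra. Qed.

Let pA := \sum_(a <= j < c z) p j.
Let qA := \sum_(a <= j < c z) q j.
Let qW := \sum_(a <= j < b) q j.

Let pA_le_cdf : pA <= cdf.
Proof.
rewrite /pA restr ?(leq_trans cb) // /cdf; apply: ler_sum => j _; apply: ler_wpM2l => //.
rewrite ler_nat; case hj : (_ && _) => //=; case/andP: hj => _.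
by rewrite /c ltnS truncn_ge_nat // => ->.
Qed.

Let cdf_le : cdf <= pA + (1 - W).
Proof.
rewrite /pA /W (restr p a (leq_trans cb bK)) (restr p a bK) -[X in _ + (X - _)]sum_p -sumrB -big_split /cdf /=.
apply: ler_sum => j _; have hp := p_ge0 j.
case hj : (j%:R <= mu + z * s)%R; last first.
  by case: (a <= j < c z)%N; case: (a <= j < b)%N; rewrite /= ?mulr0 ?mulr1; lra.
have -> : (j < c z)%N by rewrite /c ltnS truncn_ge_nat.
by rewrite andbT; case: (a <= j)%N; case: (j < b)%N; rewrite /= ?mulr0 ?mulr1; lra.
Qed.

(** Rounding up moves the left end by at most one cell, of width [1 / s <= 1]; this is the origin of
    [Phi (1 - r)] in the bounds. *)
Let x_a : x a <= 1 - r.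
Proof.
rewrite /x ler_pdivrMr // /a -natr1; case/andP: (truncn_itv t1) => t3 _.
have -> : (1 - r) * s = s - r * s by ring.
have := s1; lra.
Qed.

Let x_c : z <= x (c z) <= z + h.
Proof.
case/andP: (truncn_itv t2) => t3 t4; rewrite /x /c ler_pdivlMr // ler_pdivrMr //.
rewrite mulrDl [h * s]mulrC sh -[in X in _ && X]natr1; apply/andP; split; lra.
Qed.

Let x_b : r <= x b.
Proof.
have /truncn_itv/andP[_ t4] : 0 <= mu + r * s by rewrite addr_ge0 ?ltW.
rewrite /x /b ler_pdivlMr //; lra.
Qed.

Let qA_le : qA <= Phi (z + h).
Proof.
rewrite /qA sumq //; case/andP: x_c => _ /Phi_nondecreasing hc.
by rewrite lerBlDr; apply: le_trans hc _; rewrite lerDl Phi_ge0.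
Qed.

Let qA_ge : Phi z - Phi (1 - r) <= qA.
Proof.
rewrite /qA sumq //; case/andP: x_c => /Phi_nondecreasing hc _.
exact: lerB hc (Phi_nondecreasing x_a).
Qed.

Let qW_ge : Phi r - Phi (1 - r) <= qW.
Proof.
rewrite /qW sumq ?(leq_trans ac cb) //.
exact: lerB (Phi_nondecreasing x_b) (Phi_nondecreasing x_a).
Qed.

Let qW_le1 : qW <= 1.
Proof.
rewrite /qW sumq ?(leq_trans ac cb) // lerBlDr.
by apply: le_trans (Phi_le1 _) _; rewrite lerDl Phi_ge0.
Qed.

Let sub_win j : ((a <= j) && (j < c z))%N -> ((a <= j) && (j < b))%N.
Proof. by case/andP=> -> /= /leq_trans; apply. Qed.

Let cross (F G : nat -> R) m n m' n' : \sum_(m <= i < n) \sum_(m' <= j < n') F i * G j =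
  (\sum_(m <= i < n) F i) * (\sum_(m' <= j < n') G j).
Proof. by rewrite mulr_suml; apply: eq_bigr => i _; rewrite mulr_sumr. Qed.

Let pA_qW : pA * qW <= E * (W * qA).
Proof.
rewrite -(cross p q) -(cross p q) [X in E * X]exchange_big mulr_sumr /=.
apply: ler_sum_nat => i hi; rewrite mulr_sumr; apply: ler_sum_nat => j hj.
by apply: ratio => //; apply: sub_win.
Qed.

Let W_qA : W * qA <= E * (pA * qW).
Proof.
rewrite -(cross p q) -(cross p q) [X in E * X]exchange_big mulr_sumr /=.
apply: ler_sum_nat => i hi; rewrite mulr_sumr; apply: ler_sum_nat => j hj.
by apply: ratio => //; apply: sub_win.
Qed.

Let E0 : 0 < E. Proof. exact: expR_gt0. Qed.
Let qA0 : 0 <= qA. Proof. by apply: sumr_ge0. Qed.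
Let pA0 : 0 <= pA. Proof. by apply: sumr_ge0. Qed.
Let r2 : 0 <= 1 - (r ^+ 2)^-1.
Proof. by rewrite subr_ge0 invf_le1 ?exprn_gt0 // exprn_ege1. Qed.

(** In [pA * qW <= E * (W * qA)], Chebyshev gives [pA >= cdf - 1 / r^2], the window has Gaussian
    mass at least [Phi r - Phi (1 - r)], and [W <= 1]. *)
Lemma local_limit_cdf_le :
  (cdf - (r ^+ 2)^-1) * (Phi r - Phi (1 - r)) <= E * Phi (z + h).
Proof.
have d0 : 0 <= Phi r - Phi (1 - r).
  by rewrite subr_ge0 Phi_nondecreasing //; have := r1; lra.
apply: le_trans (_ : pA * qW <= _).
  apply: le_trans (_ : pA * (Phi r - Phi (1 - r)) <= _); last by rewrite ler_wpM2l.
  by apply: ler_wpM2r => //; have := cdf_le; have := W_ge; lra.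
apply: le_trans pA_qW _; apply: ler_wpM2l; first exact: ltW.
by apply: le_trans qA_le; apply: ler_piMl.
Qed.

Lemma local_limit_cdf_ge :
  (1 - (r ^+ 2)^-1) * (Phi z - Phi (1 - r)) <= E * cdf.
Proof.
apply: le_trans (_ : W * qA <= _).
  by apply: le_trans (_ : (1 - (r ^+ 2)^-1) * qA <= _); [apply: ler_wpM2l | apply: ler_wpM2r].
apply: le_trans W_qA _; apply: ler_wpM2l; first exact: ltW.
by apply: le_trans pA_le_cdf; apply: ler_piMr.
Qed.

End LocalLimit.

(** * Mean and variance of the hypergeometric law *)

Section HypMoments.
Variable R : realType.

Lemma bin_pred_ratio T M : (0 < M)%N -> (M <= T)%N ->
  'C(T.-1, M.-1)%:R / 'C(T, M)%:R = M%:R / T%:R :> R.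
Proof.
move=> M0 MT; have h := mul_bin_diag T M.-1; rewrite (prednK M0) in h.
have a0 : ('C(T, M)%:R : R) != 0 by rewrite pnatr_eq0 -lt0n bin_gt0.
have b0 : (T%:R : R) != 0 by rewrite pnatr_eq0 -lt0n (leq_trans M0).
apply/eqP; rewrite eqr_div //; apply/eqP.
by have := congr1 (fun x => x%:R : R) h; rewrite !natrM mulrC.
Qed.

Lemma hyp_mean_id K L M : (0 < K)%N -> (0 < M)%N -> (M <= K + L)%N ->
  hyp_mean K L M (fun j => j%:R) = K%:R * M%:R / (K + L)%:R :> R.
Proof.
move=> K0 M0 ML.
rewrite (eq_hyp_mean _ _ _ (G := fun d => 'C(d, 1)%:R * 1)); last by move=> d; rewrite bin1 mulr1.
rewrite hyp_mean_size_bias // hyp_mean_const; last by lia.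
have -> : (K - 1 + L = (K + L).-1)%N by lia.
by rewrite bin1 subn1 mulr1 -mulrA bin_pred_ratio // mulrA.
Qed.

(** Expand [(d - mu)^2 = 2 'C(d, 2) + (1 - 2 mu) d + mu^2]. As
    [(K - 1) (M - 1) / (K + L - 1) <= mu], the second factorial moment is at most [mu^2], its value
    for a Poisson variable. *)
Lemma hyp_var_le K L M : (1 < K)%N -> (1 < M)%N -> (M <= K + L)%N ->
  let mu := K%:R * M%:R / (K + L)%:R in
  hyp_mean K L M (fun j => (j%:R - mu) ^+ 2) <= mu :> R.
Proof.
move=> K1 M1 ML; cbv zeta; set mu := _ / _.
have e1 : hyp_mean K L M (fun j => j%:R) = mu by apply: hyp_mean_id => //; lia.
rewrite (eq_hyp_mean _ _ _ (G := fun d =>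
   2 * ('C(d, 2)%:R * 1) + ((1 - 2 * mu) * d%:R + mu ^+ 2))); last first.
  move=> d; have : 2 * 'C(d, 2)%:R = d%:R * (d%:R - 1) :> R.
    case: d => [|d]; first by rewrite mul0r mulr0.
    have := mul_bin_diag d.+1 1; rewrite bin1 /= => /(congr1 (fun x => x%:R : R)).
    by rewrite !natrM -natr1 addrK => <-.
  by rewrite mulr1 => ->; ring.
rewrite hyp_meanD hyp_meanZ hyp_meanD hyp_meanZ e1 hyp_mean_const // hyp_mean_size_bias //.
rewrite hyp_mean_const; last by lia.
have TE : (0 < (K + L)%:R :> R) by rewrite ltr0n; lia.
have T1E : (0 < (K + L).-1%:R :> R) by rewrite ltr0n; lia.
have -> : 'C(K, 2)%:R * 'C(K - 2 + L, M - 2)%:R / 'C(K + L, M)%:R =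
   'C(K, 2)%:R * (M%:R / (K + L)%:R * (M.-1%:R / (K + L).-1%:R)) :> R.
  rewrite -bin_pred_ratio //; last by lia.
  rewrite -(@bin_pred_ratio (K + L).-1 M.-1); [|lia|lia].
  have -> : (K - 2 + L = (K + L).-2)%N by lia.
  have -> : (M - 2 = M.-2)%N by lia.
  have a0 : ('C(K + L, M)%:R : R) != 0 by rewrite pnatr_eq0 -lt0n bin_gt0.
  have b0 : ('C((K + L).-1, M.-1)%:R : R) != 0 by rewrite pnatr_eq0 -lt0n bin_gt0; lia.
  by field; rewrite a0 b0.
have c2 : 2 * 'C(K, 2)%:R = K%:R * K.-1%:R :> R.
  by rewrite -!natrM; congr (_%:R); rewrite -(mul_bin_diag K 1) bin1.
have -> : 2 * ('C(K, 2)%:R * (M%:R / (K + L)%:R * (M.-1%:R / (K + L).-1%:R)) * 1) =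
  mu * (K.-1%:R * M.-1%:R / (K + L).-1%:R) :> R.
  rewrite mulr1 mulrA c2 /mu; move: TE T1E; clear.
  move: (K + L)%:R (K + L).-1%:R => x y x0 y0.
  by field; rewrite !gt_eqF.
have mu0 : 0 <= mu by rewrite /mu divr_ge0 // mulr_ge0.
have : K.-1%:R * M.-1%:R / (K + L).-1%:R <= mu.
  rewrite /mu ler_pdivrMr // mulrAC ler_pdivlMr // -!natrM ler_nat.
  have h1 : (K.-1 * (K + L) <= K * (K + L).-1)%N by nia.
  have h2 : (M.-1 <= M)%N by lia.
  by have := leq_mul h1 h2; rewrite mulnAC [leqRHS]mulnAC.
move=> h; have := ler_wpM2l mu0 h; lra.
Qed.

End HypMoments.

(** * Ratios of consecutive hypergeometric probabilities *)

Section HypRatio.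
Variable R : realType.

(** The closing linear estimate, with its quantities abstracted. Three logarithms are bounded to
    first order; [l4], which carries the drift, is expanded to second order. *)
Let fin (n1 n2 n3 z1 z2 z3 z4 l1 l2 l3 l4 t : R) : 0 <= z3 -> n1 <= z1 -> n2 <= z1 -> n3 <= z1 ->
  `|l1| <= 2 * n1 -> `|l2| <= 2 * n2 -> `|l3| <= 2 * n3 -> `|l4 - (t + z3)| <= z4 -> z4 <= z2 ->
  `|l1 + l2 - (l4 + l3) + t| <= 6 * z1 + z2 + z3.
Proof.
rewrite !ler_norml => ? ? ? ? /andP[? ?] /andP[? ?] /andP[? ?] /andP[? ?] ?.
apply/andP; split; lra.
Qed.

(* The window lies in the region where each factor of the ratio
   [(A - t) (A' - t) / ((mu + t + 1) (D + t + 1))] is close to its value at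
   [t = 0], except [mu + t + 1], which produces the drift [- t / mu]. *)
Lemma ln_ratio_drift (A A' D mu s r eps t : R) :
  1 <= r -> 2 * (r + 1) <= s -> s ^+ 2 = mu -> 0 < eps -> eps <= 2^-1 ->
  0 < A -> 0 < A' -> A * A' = mu * D -> mu <= 2 * eps * A -> mu <= 2 * eps * A' ->
  `|t| <= r * s ->
  [/\ 0 < A - t, 0 < A' - t, 0 < mu + t + 1, 0 < D + t + 1 &
  `|ln (((A - t) * (A' - t)) / ((mu + t + 1) * (D + t + 1))) + t / mu| <=
   (12 * (r + 1) * eps + (2 * (r + 1) ^+ 2 + 1) / s) / s].
Proof.
move=> r1 sr smu e0 e1 A0 A0' AD mA mA' ht.
have s0 : 0 < s by lra.
have mu0 : 0 < mu by rewrite -smu exprn_gt0.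
have D0 : 0 < D by rewrite -(pmulr_rgt0 _ mu0) -AD mulr_gt0.
(* Multiplying the bounds on [A] and [A'] gives [mu <= (2 eps)^2 D], and [2 eps <= 1]. *)
have mD : mu <= 2 * eps * D.
  have h : mu * mu <= (2 * eps * A) * (2 * eps * A').
    by apply: ler_pM => //; exact: ltW.
  have h2 : (2 * eps * A) * (2 * eps * A') = mu * (2 * eps * (2 * eps * D)).
    have -> : 2 * eps * A * (2 * eps * A') = (2 * eps) ^+ 2 * (A * A') by ring.
    by rewrite AD; ring.
  rewrite h2 ler_pM2l // in h; apply: le_trans h _.
  have e2 : 0 < 2 * eps by rewrite mulr_gt0.
  rewrite ler_pM2l //; apply: ler_piMl; [exact: ltW | lra].
have small (x X : R) : 0 < X -> mu <= 2 * eps * X -> `|x| <= (r + 1) * s ->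
    `|x / X| <= 2 * (r + 1) * eps / s.
  move=> X0 hX hx; rewrite normrM [`|X^-1|]gtr0_norm ?invr_gt0 // ler_pdivrMr //.
  apply: le_trans hx _; rewrite mulrAC ler_pdivlMr //.
  have -> : (r + 1) * s * s = (r + 1) * mu by rewrite -smu; ring.
  have -> : 2 * (r + 1) * eps * X = (r + 1) * (2 * eps * X) by ring.
  by rewrite ler_pM2l //; lra.
have half : 2 * (r + 1) * eps / s <= 2^-1.
  rewrite ler_pdivrMr // [leRHS]mulrC; apply: le_trans (_ : 2 * (r + 1) * 2^-1 <= _).
    by rewrite ler_pM2l //; lra.
  by rewrite ler_pM2r ?invr_gt0.
have rs1 : 1 <= s by lra.
have ht1 : `|t| <= (r + 1) * s by apply: le_trans ht _; rewrite ler_pM2r //; lra.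
have htN : `|- t| <= (r + 1) * s by rewrite normrN.
have ht2 : `|t + 1| <= (r + 1) * s.
  by apply: le_trans (ler_normD _ _) _; rewrite normr1 mulrDl mul1r lerD.
have v_le : `|(t + 1) / mu| <= (r + 1) / s.
  rewrite normrM [`|mu^-1|]gtr0_norm ?invr_gt0 // ler_pdivrMr //.
  apply: le_trans ht2 _; rewrite -smu expr2 mulrA -[(r + 1) / s * s]mulrA mulVf ?mulr1 //.
  by rewrite gt_eqF.
have v_half : `|(t + 1) / mu| <= 2^-1.
  by apply: le_trans v_le _; rewrite ler_pdivrMr //; lra.
have a1 := small _ _ A0 mA htN; have a2 := small _ _ A0' mA' htN.
have a3 := small _ _ D0 mD ht2.
have pos1 (x : R) : `|x| <= 2^-1 -> 0 < 1 + x.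
  by rewrite ler_norml => /andP[+ _]; lra.
have q1 := pos1 _ (le_trans a1 half); have q2 := pos1 _ (le_trans a2 half).
have q3 := pos1 _ (le_trans a3 half); have q4 := pos1 _ v_half.
have eA : A - t = A * (1 + - t / A) by field; rewrite gt_eqF.
have eA' : A' - t = A' * (1 + - t / A') by field; rewrite gt_eqF.
have eD : D + t + 1 = D * (1 + (t + 1) / D) by field; rewrite gt_eqF.
have emu : mu + t + 1 = mu * (1 + (t + 1) / mu) by field; rewrite gt_eqF.
split; rewrite ?eA ?eA' ?eD ?emu ?mulr_gt0 //.
have -> : A * (1 + - t / A) * (A' * (1 + - t / A')) /
   (mu * (1 + (t + 1) / mu) * (D * (1 + (t + 1) / D))) =
   ((1 + - t / A) * (1 + - t / A')) / ((1 + (t + 1) / mu) * (1 + (t + 1) / D)).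
  rewrite mulrACA [X in _ / X]mulrACA AD -mulf_div divff ?mul1r //.
  by rewrite gt_eqF // mulr_gt0.
rewrite ln_div ?posrE ?mulr_gt0 // !lnM ?posrE //.
have b1 := norm_ln1D (le_trans a1 half); have b2 := norm_ln1D (le_trans a2 half).
have b3 := norm_ln1D (le_trans a3 half); have b4 := ln1D_approx v_half.
have c4 : 2 * ((t + 1) / mu) ^+ 2 <= 2 * (r + 1) ^+ 2 / s / s.
  rewrite -[(_ / mu) ^+ 2]real_normK ?num_real // -!mulrA ler_pM2l //.
  apply: le_trans (_ : ((r + 1) / s) ^+ 2 <= _).
    by apply: lerXn2r; rewrite ?nnegrE // divr_ge0 ?ltW //; lra.
  by rewrite exprMn expr2 -mulrA exprVn expr2 invfM.
have e4 : (t + 1) / mu = t / mu + s^-1 / s by rewrite -smu; field; rewrite gt_eqF.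
(* Three factors cost [4 (r + 1) eps / s] each. The factor at [mu] costs its quadratic remainder
   and, since [(t + 1) / mu = t / mu + 1 / s^2], a further [1 / s^2]. *)
have -> : (12 * (r + 1) * eps + (2 * (r + 1) ^+ 2 + 1) / s) / s =
  6 * (2 * (r + 1) * eps / s) + 2 * (r + 1) ^+ 2 / s / s + s^-1 / s.
  by field; rewrite gt_eqF.
rewrite e4 in b4 c4 *; have z0 : 0 <= s^-1 / s by rewrite divr_ge0 ?invr_ge0 ?(ltW s0).
exact: fin z0 a1 a2 a3 b1 b2 b3 b4 c4.
Qed.

End HypRatio.

Section HypCLT.
Variable R : realType.

Lemma binm_step K L M j : (j < K)%N -> (j < M)%N -> (M <= L)%N ->
  ('C(K, j.+1) * binm L M j.+1 * (j.+1 * (L - M + j.+1)) =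
   'C(K, j) * binm L M j * ((K - j) * (M - j)))%N.
Proof.
move=> jK jM ML; rewrite /binm jM (ltnW jM).
have h1 := mul_bin_left K j; have h2 := mul_bin_left L (M - j.+1).
have e1 : ((M - j.+1).+1 = M - j)%N by lia.
have e2 : (L - (M - j.+1) = L - M + j.+1)%N by lia.
rewrite e1 e2 in h2.
transitivity ((j.+1 * 'C(K, j.+1)) * ((L - M + j.+1) * 'C(L, M - j.+1)))%N; first by ring.
by rewrite h1 -h2; ring.
Qed.

Lemma hyp_cdf_bounds (K L M : nat) (s r eps z : R) :
  let mu : R := K%:R * M%:R / (K + L)%:R in
  let F := hyp_mean K L M (fun j => (j%:R <= mu + z * s)%R%:R) in
  let E := expR (2 * r * (12 * (r + 1) * eps + (2 * (r + 1) ^+ 2 + 1) / s) +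
                 (3 * r + 1) / s) in
  s ^+ 2 = mu -> 1 <= r -> 2 * (r + 1) <= s -> 0 < eps -> eps <= 2^-1 ->
  M%:R <= eps * (K + L)%:R -> K%:R <= eps * (K + L)%:R -> `|z| <= r ->
  (F - (r ^+ 2)^-1) * (Phi r - Phi (1 - r)) <= E * Phi (z + s^-1) /\
  (1 - (r ^+ 2)^-1) * (Phi z - Phi (1 - r)) <= E * F.
Proof.
cbv zeta; set mu := _ / _; set F := hyp_mean _ _ _ _; set E := expR _.
move=> smu r1 sr e0 e1 hM hK hz.
have s1 : 1 <= s by lra.
have s0 : 0 < s by lra.
have mu0 : 0 < mu by rewrite -smu exprn_gt0.
have r0 : 0 < r by lra.
have rs0 : 0 <= r * s by rewrite mulr_ge0 ?ltW.
have T0 : 0 < (K + L)%:R :> R.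
  rewrite ltr0n lt0n; apply: contraTneq mu0 => T0.
  by rewrite /mu T0 invr0 mulr0 ltxx.
have M0 : 0 < M%:R :> R.
  rewrite ltr0n lt0n; apply: contraTneq mu0 => M0.
  by rewrite /mu M0 mulr0 mul0r ltxx.
have K0 : 0 < K%:R :> R.
  rewrite ltr0n lt0n; apply: contraTneq mu0 => K0.
  by rewrite /mu K0 !mul0r ltxx.
have muK : mu <= eps * K%:R.
  by rewrite /mu ler_pdivrMr // [leLHS]mulrC mulrAC ler_pM2r.
have muM : mu <= eps * M%:R.
  by rewrite /mu ler_pdivrMr // mulrAC ler_pM2r.
have half (X : R) : 0 < X -> mu <= eps * X -> 0 < X - mu /\ mu <= 2 * eps * (X - mu).
  move=> X0 hX; have h : eps * X <= 2^-1 * X by rewrite ler_pM2r.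
  have hh : eps * X <= 2 * eps * (X - mu).
    have -> : 2 * eps * (X - mu) = eps * (2 * (X - mu)) by ring.
    rewrite ler_pM2l //; lra.
  split; [lra|exact: le_trans hX hh].
have [A0 mA] := half _ K0 muK; have [A0' mA'] := half _ M0 muM.
(* This says that [(K - j) (M - j) / (j (L - M + j))] equals 1 at [j = mu], which is why the
   logarithm of the ratio has no constant term there. *)
have AD : (K%:R - mu) * (M%:R - mu) = mu * (L%:R - M%:R + mu).
  have T0' : K%:R + L%:R != 0 :> R by rewrite -natrD gt_eqF.
  by rewrite /mu natrD; field.
have hTT : K%:R + M%:R <= K%:R + L%:R :> R.
  have : eps * (K + L)%:R <= 2^-1 * (K + L)%:R by rewrite ler_pM2r.
  by move: hM hK; rewrite natrD; lra.
have ML : (M <= L)%N by rewrite -(ler_nat R); lra.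
have drift := ln_ratio_drift r1 sr smu e0 e1 A0 A0' AD mA mA'.
pose p j : R := ('C(K + L, M)%:R)^-1 * ('C(K, j) * binm L M j)%:R.
have CT : 0 < ('C(K + L, M)%:R : R).
  by rewrite ltr0n bin_gt0 (leq_trans ML) // leq_addl.
have hpE (G : nat -> R) : hyp_mean K L M G = \sum_(0 <= j < K.+1) p j * G j.
  by rewrite /hyp_mean mulr_sumr big_mkord; apply: eq_bigr => j _; rewrite mulrA.
have MT : (M <= K + L)%N by rewrite (leq_trans ML) // leq_addl.
have rK : mu + r * s < K%:R.
  have [|h _ _ _ _] := drift (r * s); first by rewrite ger0_norm.
  by move: h; rewrite -addrA -opprD subr_gt0.
have jlt j : `|j%:R - mu| <= r * s -> (j < K)%N /\ (j < M)%N.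
  move=> hj; have [h1 h2 _ _ _] := drift _ hj.
  by rewrite -!(ltr_nat R); split; lra.
have mu1 : 1 < mu.
  by rewrite -smu exprn_egt1 //; lra.
have mugt (X : R) : 0 < X -> mu <= eps * X -> 1 < X.
  move=> X0 h; have : eps * X <= 2^-1 * X by rewrite ler_pM2r.
  lra.
have K1 : (1 < K)%N by rewrite -(ltr_nat R) mugt.
have M1 : (1 < M)%N by rewrite -(ltr_nat R) mugt.
have p_ge0 j : 0 <= p j by rewrite mulr_ge0 // invr_ge0 ltW.
have p_gt0 j : `|j%:R - mu| <= r * s -> 0 < p j.
  case/jlt => jK jM; rewrite mulr_gt0 ?invr_gt0 // ltr0n muln_gt0 bin_gt0 (ltnW jK) /=.
  by rewrite /binm (ltnW jM) bin_gt0 (leq_trans (leq_subr _ _)).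
have sum_p : \sum_(0 <= j < K.+1) p j = 1.
  rewrite -[RHS](@hyp_mean_const R K L M 1) // hpE.
  by apply: eq_bigr => j _; rewrite mulr1.
have var_p : \sum_(0 <= j < K.+1) p j * (j%:R - mu) ^+ 2 <= mu.
  by rewrite -(hpE (fun j => (j%:R - mu) ^+ 2)); exact: hyp_var_le.
set kap := 12 * (r + 1) * eps + (2 * (r + 1) ^+ 2 + 1) / s in E *.
have p_step j : `|j%:R - mu| <= r * s -> `|j.+1%:R - mu| <= r * s ->
     `|ln (p j.+1) - ln (p j) + (j%:R - mu) / mu| <= kap / s.
  move=> hj hj1; have [h1 h2 h3 h4] := drift _ hj.
  have [jK jM] := jlt _ hj.
  have -> : ln (p j.+1) - ln (p j) = ln (p j.+1 / p j) by rewrite ln_div ?posrE ?p_gt0.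
  suff -> : p j.+1 / p j = (K%:R - mu - (j%:R - mu)) * (M%:R - mu - (j%:R - mu)) /
      ((mu + (j%:R - mu) + 1) * (L%:R - M%:R + mu + (j%:R - mu) + 1)) by [].
  have d0 : (mu + (j%:R - mu) + 1) * (L%:R - M%:R + mu + (j%:R - mu) + 1) != 0.
    by rewrite gt_eqF // mulr_gt0.
  have pj0 : p j != 0 by rewrite gt_eqF ?p_gt0.
  apply/eqP; rewrite eqr_div //; apply/eqP.
  have -> : K%:R - mu - (j%:R - mu) = (K - j)%:R by rewrite natrB ?(ltnW jK) //; ring.
  have -> : M%:R - mu - (j%:R - mu) = (M - j)%:R by rewrite natrB ?(ltnW jM) //; ring.
  have -> : mu + (j%:R - mu) + 1 = j.+1%:R by rewrite -natr1; ring.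
  have -> : L%:R - M%:R + mu + (j%:R - mu) + 1 = (L - M + j.+1)%:R.
    by rewrite natrD natrB // -natr1; ring.
  have := congr1 (fun x => x%:R : R) (binm_step jK jM ML).
  rewrite /p !(natrM _ (_ * _) (_ * _)) => e.
  rewrite -!natrM -mulrA -natrM binm_step // natrM; ring.
have kap0 : 0 <= kap.
  rewrite addr_ge0 ?divr_ge0 ?mulr_ge0 ?addr_ge0 ?mulr_ge0 ?sqr_ge0 //; lra.
have rsmu : r * s <= mu by rewrite -smu expr2 ler_pM2r //; lra.
have EE : E = expR (2 * r * s * (kap / s) + (3 * r + 1) * s^-1).
  by rewrite /E; congr expR; congr (_ + _); field; rewrite gt_eqF.
have FE : F = \sum_(0 <= j < K.+1) p j * (j%:R <= mu + z * s)%R%:R by exact: hpE.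
have kap1 : 0 <= kap / s by rewrite divr_ge0 // ltW.
rewrite EE FE; split.
  exact: (local_limit_cdf_le kap1 s1 smu r1 rsmu rK p_ge0 sum_p var_p p_gt0 p_step hz).
exact: (local_limit_cdf_ge kap1 s1 smu r1 rsmu rK p_ge0 sum_p var_p p_gt0 p_step hz).
Qed.

End HypCLT.

(** * Passage to the limit in the central limit theorem *)

Section HypLimit.
Variable R : realType.

Lemma Phi_shift_le (z h : R) : 0 < h -> Phi (z + h) <= Phi z + normal_peak 1 * h.
Proof.
move=> h0; have [|x _ e] := Phi_mvt (x := z) (y := z + h); first by rewrite ltrDl.
rewrite -lerBlDl e (addrC z) addrK ler_pM2r // normal_pdf_ub // oner_eq0.
Qed.

Lemma expR_le_affine (x : R) : 0 <= x -> x <= 2^-1 -> expR x <= 1 + 2 * x.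
Proof.
move=> x0 x1; have h := expR_ge1Dx (- x); rewrite expRN in h.
have e0 := expR_gt0 x.
have d0 : 0 < 1 - x by lra.
have : (1 - x) * expR x <= 1 by rewrite -ler_pdivlMr ?div1r.
move=> h2; rewrite -(ler_pM2l d0); apply: le_trans h2 _.
have := sqr_ge0 x; have : x * x <= 2^-1 * x by rewrite ler_wpM2r.
rewrite expr2; lra.
Qed.

Lemma Phi_window (delta z : R) : 0 < delta -> exists r : R,
  [/\ 1 <= r, `|z| <= r, (r ^+ 2)^-1 <= delta, 1 - delta <= Phi r & Phi (1 - r) <= delta].
Proof.
move=> d0.
have /cvgrPdist_le/(_ _ d0) h1 := @Phi_cvgy R.
have /cvgrPdist_le/(_ _ d0) [M [_ h2]] := @Phi_cvgNy R.
near (pinfty_nbhs R) => r.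
have r1 : 1 <= r by near: r; apply: nbhs_pinfty_ge; rewrite num_real.
have rz : `|z| <= r by near: r; apply: nbhs_pinfty_ge; rewrite num_real.
have rd : delta^-1 <= r by near: r; apply: nbhs_pinfty_ge; rewrite num_real.
have rP : `|1 - Phi r| <= delta by near: r.
have rM : 1 - M < r by near: r; apply: nbhs_pinfty_gt; rewrite num_real.
have r0 : 0 < r := lt_le_trans ltr01 r1.
exists r; split => //.
- rewrite -[leRHS]invrK lef_pV2 ?posrE ?invr_gt0 ?exprn_gt0 //.
  by apply: le_trans rd _; rewrite expr2 ler_peMr // (le_trans ler01).
- by move: rP; rewrite ler_norml => /andP[_]; lra.
have : `|0 - Phi (1 - r)| <= delta by apply: h2; lra.
by rewrite sub0r normrN ger0_norm ?Phi_ge0.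
Unshelve. all: by end_near.
Qed.

(** Here [F] is the hypergeometric distribution function, [w = Phi z], [a = 1 / r^2],
    [b = Phi (1 - r)], [P = Phi r], [v = Phi (z + 1 / s)], and [d] bounds every error. *)
Let final_bounds (F w a b P E v d : R) : 0 < d -> d <= 2^-1 -> 0 <= F <= 1 -> 0 <= w <= 1 ->
  0 <= a <= d -> 0 <= b <= d -> 1 - d <= P <= 1 -> E <= 1 + 2 * d -> 0 <= E -> v <= w + d ->
  0 <= v ->
  (F - a) * (P - b) <= E * v -> (1 - a) * (w - b) <= E * F -> `|w - F| <= 8 * d.
Proof.
move=> d0 d1 /andP[F0 F1] /andP[w0 w1] /andP[a0 a1] /andP[b0 b1] /andP[P0 P1] hE E0 hv v0 h1 h2.
have u1 : E * v <= (1 + 2 * d) * (w + d) by apply: ler_pM.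
have u2 : d * d <= 2^-1 * d by rewrite ler_wpM2r // ltW.
have u3 : d * w <= d * 1 by rewrite ler_wpM2l // ltW.
have u4 : E * F <= (1 + 2 * d) * F by apply: ler_wpM2r.
have u5 : d * F <= d * 1 by rewrite ler_wpM2l // ltW.
have u6 : (1 - 2 * d) * F <= (P - b) * F by apply: ler_wpM2r => //; lra.
have u7 : a * (P - b) <= d * 1 by apply: ler_pM => //; lra.
have u8 : a * w <= d * w by apply: ler_wpM2r.
have u9 : 0 <= a * b by rewrite mulr_ge0.
have u10 : 0 <= d * w by rewrite mulr_ge0 // ltW.
have u11 : 0 <= d * F by rewrite mulr_ge0 // ltW.
rewrite ler_norml; apply/andP; split; lra.
Qed.

(** Scaling by [sqrt mu] is correct because both the fraction drawn and the fraction marked vanish,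
    so that the variance is asymptotic to the mean. The window [r] is fixed first, then [eps], then
    the lower bound [S] on [s]. *)
Lemma hyp_clt (K L M : nat -> nat) (z : R) :
  let mu n : R := (K n)%:R * (M n)%:R / (K n + L n)%:R in
  mu n @[n --> \oo] --> +oo ->
  (M n)%:R / (K n + L n)%:R @[n --> \oo] --> (0 : R) ->
  (K n)%:R / (K n + L n)%:R @[n --> \oo] --> (0 : R) ->
  hyp_mean (K n) (L n) (M n) (fun j => (j%:R <= mu n + z * Num.sqrt (mu n))%R%:R)
    @[n --> \oo] --> Phi z.
Proof.
move=> mu hmu hM hK; apply/cvgrPdist_le => e e0.
pose d : R := Num.min (e / 8) 2^-1.
have d0 : 0 < d by rewrite lt_min divr_gt0 //= invr_gt0.
have d1 : d <= 2^-1 by rewrite ge_min lexx orbT.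
have de : 8 * d <= e by rewrite -ler_pdivlMl // mulrC ge_min lexx.
have [r [r1 rz ra rP rb]] := Phi_window z d0.
have r0 : 0 < r := lt_le_trans ltr01 r1.
(* Chosen so that [2 r * 12 (r + 1) eps = d / 2]; [c1] below collects the coefficient of [1 / s] in
   the same exponent. *)
pose eps : R := d / (48 * r * (r + 1)).
have q0 : 0 < 48 * r * (r + 1) by rewrite !mulr_gt0 // addr_gt0.
have eps0 : 0 < eps by rewrite divr_gt0.
have q1 : 1 <= 48 * r * (r + 1).
  have : 1 * 1 <= r * (r + 1) by apply: ler_pM => //; lra.
  rewrite -mulrA; lra.
have eps1 : eps <= 2^-1.
  by apply: le_trans d1; rewrite ler_pdivrMr // ler_peMr // ltW.
pose c1 : R := 2 * r * (2 * (r + 1) ^+ 2 + 1) + (3 * r + 1).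
have c10 : 0 < c1.
  have := sqr_ge0 (r + 1) => h; rewrite addr_gt0 //; last lra.
  by rewrite !mulr_gt0 //; lra.
(* The three summands ensure, for [s >= S], the condition [2 (r + 1) <= s], the bound
   [c1 / s <= d / 2], and a shift of [Phi] by at most [d]. *)
pose S : R := 2 * (r + 1) + 2 * c1 / d + normal_peak 1 / d.
have pk0 := @normal_peak_ge0 R 1.
have cd0 : 0 < c1 / d by rewrite divr_gt0.
have pd0 : 0 <= normal_peak 1 / d by rewrite divr_ge0 // ltW.
have S0 : 0 < S by rewrite /S -mulrA; lra.
move/cvgryPge : hmu => /(_ (S ^+ 2)) hmu.
move/cvgrPdist_le : hM => /(_ _ eps0) hM; move/cvgrPdist_le : hK => /(_ _ eps0) hK.
near=> n; apply: le_trans de.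
have muS : S ^+ 2 <= mu n by near: n.
have mu0 : 0 < mu n by apply: lt_le_trans muS; rewrite exprn_gt0.
have T0 : 0 < (K n + L n)%:R :> R.
  rewrite ltr0n lt0n; apply: contraTneq mu0 => T0.
  by rewrite /mu T0 invr0 mulr0 ltxx.
have hM' : (M n)%:R <= eps * (K n + L n)%:R.
  rewrite -ler_pdivrMr //; have : `|0 - (M n)%:R / (K n + L n)%:R| <= eps by near: n.
  by rewrite sub0r normrN ger0_norm // divr_ge0.
have hK' : (K n)%:R <= eps * (K n + L n)%:R.
  rewrite -ler_pdivrMr //; have : `|0 - (K n)%:R / (K n + L n)%:R| <= eps by near: n.
  by rewrite sub0r normrN ger0_norm // divr_ge0.
set s := Num.sqrt (mu n).
have smu : s ^+ 2 = mu n by rewrite sqr_sqrtr // ltW.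
have Ss : S <= s.
  by rewrite -[S]gtr0_norm // -sqrtr_sqr ler_wsqrtr.
have s0 : 0 < s by exact: lt_le_trans Ss.
have sr : 2 * (r + 1) <= s by apply: le_trans Ss; rewrite /S -mulrA; lra.
have s_c1 : c1 / s <= d / 2.
  rewrite ler_pdivrMr // -ler_pdivrMl ?divr_gt0 //.
  have -> : (d / 2)^-1 * c1 = 2 * c1 / d by rewrite invf_div mulrAC.
  by apply: le_trans Ss; rewrite /S -mulrA; have : 0 <= 2 * (r + 1); lra.
have s_pk : normal_peak 1 * s^-1 <= d.
  rewrite ler_pdivrMr // -ler_pdivrMl // mulrC.
  by apply: le_trans Ss; rewrite /S -mulrA; lra.
have [] := hyp_cdf_bounds smu r1 sr eps0 eps1 hM' hK' rz.
set E := expR _; rewrite -/s; set F := hyp_mean _ _ _ _ => b1 b2.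
have expo : E <= 1 + 2 * d.
  have -> : E = expR (d / 2 + c1 / s).
    rewrite /E /c1 /eps; congr expR; field.
    by rewrite !gt_eqF //; lra.
  have hd : d / 2 + c1 / s <= d by lra.
  apply: le_trans (_ : expR d <= _); first by rewrite ler_expR.
  by apply: expR_le_affine => //; exact: ltW.
have MKL : (M n <= K n + L n)%N.
  rewrite -(ler_nat R); apply: le_trans hM' _; rewrite ler_piMl //; lra.
have F01 : 0 <= F <= 1.
  have m0 := @hyp_mean_const R (K n) (L n) (M n) 0 MKL.
  have m1 := @hyp_mean_const R (K n) (L n) (M n) 1 MKL.
  apply/andP; split; [rewrite -m0 | rewrite -m1]; apply: ler_hyp_mean => j _.
    exact: ler0n.
  by case: (j%:R <= _)%R => /=; [exact: lexx | exact: ler01].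
apply: (final_bounds d0 d1 F01 _ _ _ _ expo _ _ _ b1 b2).
- by rewrite Phi_ge0 Phi_le1.
- by rewrite ra invr_ge0 exprn_ge0 // ltW.
- by rewrite rb Phi_ge0.
- by rewrite rP Phi_le1.
- exact/ltW/expR_gt0.
- by apply: le_trans (Phi_shift_le _ _) _; rewrite ?invr_gt0 // lerD2l.
- exact: Phi_ge0.
Unshelve. all: by end_near.
Qed.

End HypLimit.

(** * Product form and expansion of the likelihood ratio *)

Section LikelihoodRatio.
Variable R : realType.

Lemma ln_prod k (F : nat -> R) : (forall i, (i < k)%N -> 0 < F i) ->
  ln (\prod_(i < k) F i) = \sum_(i < k) ln (F i).
Proof.
elim: k => [|k IH] hF; first by rewrite !big_ord0 ln1.
rewrite !big_ord_recr /= lnM ?posrE ?hF ?IH // => [i ik|]; first by rewrite hF // ltnW.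
by apply: prodr_gt0 => i _; rewrite hF // ltnS ltnW.
Qed.

Lemma ffact_rising k j : ((k + j) ^_ k = \prod_(i < k) (j + i.+1))%N.
Proof.
elim: k => [|k IH]; first by rewrite ffactn0 big_ord0.
by rewrite addSn ffactSS IH big_ord_recr /= mulnC addnS addnC.
Qed.

Lemma bin_ffact_ratio N m k : (k <= m)%N -> (m <= N)%N ->
  ('C(N, m) * m ^_ k = N ^_ k * 'C(N - k, m - k))%N.
Proof.
move=> km mN.
have f0 : (0 < (m - k)`! * (N - m)`!)%N by rewrite muln_gt0 !fact_gt0.
apply/eqP; rewrite -(eqn_pmul2r f0); apply/eqP.
have e1 := bin_fact mN; have e2 := ffact_fact km.
have e3 := ffact_fact (leq_trans km mN).
have e4 : ('C(N - k, m - k) * ((m - k)`! * (N - m)`!) = (N - k)`!)%N.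
  have -> : (N - m = N - k - (m - k))%N by clear -km mN; lia.
  by rewrite bin_fact // leq_sub2r.
transitivity (N`!)%N; first by rewrite -e1 -e2; ring.
by rewrite -e3 -e4; ring.
Qed.

Lemma sum_succ k : \sum_(i < k) (i.+1)%:R = k%:R * (k%:R + 1) / 2 :> R.
Proof.
elim: k => [|k IH]; first by rewrite big_ord0 mul0r mul0r.
by rewrite big_ord_recr /= IH -!natr1; field.
Qed.

Variables (n m k : nat).
Hypotheses (n1 : (1 < n)%N) (kn : (2 * k <= n.-1)%N) (km : (2 * k <= m)%N)
  (m0 : (0 < m)%N) (mN : (m <= 'C(n, 2))%N).

Let N := 'C(n, 2).
Let lam : R := 2 * m%:R / n%:R.
(** The correction for sampling without replacement: as [lam N = (n - 1) m], it equals
    [(1 - i/N) / ((1 - i/(n-1)) (1 - i/m))]. *)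
Let c (i : nat) : R := lam * (N - i)%:R / ((n.-1 - i)%:R * (m - i)%:R).

Let n0 : 0 < n%:R :> R. Proof. by rewrite ltr0n; lia. Qed.
Let K0 : 0 < n.-1%:R :> R. Proof. by rewrite ltr0n; lia. Qed.
Let mR0 : 0 < m%:R :> R. Proof. by rewrite ltr0n. Qed.
Let lam0 : 0 < lam. Proof. by rewrite divr_gt0 // mulr_gt0. Qed.

Let lamN : lam * N%:R = n.-1%:R * m%:R.
Proof.
have : n%:R * n.-1%:R = 2 * N%:R :> R.
  by rewrite -!natrM; congr (_%:R); rewrite -[RHS](mul_bin_diag n 1) bin1.
rewrite /lam => e; apply: (mulfI (lt0r_neq0 n0)).
have -> : n%:R * (2 * m%:R / n%:R * N%:R) = m%:R * (2 * N%:R) :> R by field; rewrite gt_eqF.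
by rewrite -e; ring.
Qed.

Let kN : (n.-1 <= N)%N := leq_pred_bin2 n.

(** The factors [(j + i + 1) / lam] form the likelihood ratio for Poisson degrees of mean [lam]. *)
Lemma ell_prodE j :
  ell R n m k (k + j) = \prod_(i < k) ((j + i.+1)%:R / lam * c i).
Proof.
have km' : (k <= m)%N by clear -km; lia.
have kn' : (k <= n.-1)%N by clear -kn; lia.
have e1 := bin_ffact_ratio km' mN.
have e2 := bin_ffact (k + j) k; have e3 := bin_ffact n.-1 k.
have -> : ell R n m k (k + j) = ((k + j) ^_ k * N ^_ k)%:R / (n.-1 ^_ k * m ^_ k)%:R.
  have p1 : ('C(n.-1, k) * 'C(N - k, m - k))%:R != 0 :> R.
    by rewrite pnatr_eq0 -lt0n muln_gt0 !bin_gt0 kn' leq_sub2r.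
  have p2 : (n.-1 ^_ k * m ^_ k)%:R != 0 :> R.
    by rewrite pnatr_eq0 -lt0n muln_gt0 !ffact_gt0 kn'.
  apply/eqP; rewrite /ell -/N eqr_div // -!natrM; apply/eqP; congr (_%:R).
  rewrite -e2 -e3.
  transitivity ('C(k + j, k) * k`! * 'C(n.-1, k) * ('C(N, m) * m ^_ k))%N; first by ring.
  by rewrite e1; ring.
rewrite ffact_rising !ffact_prod !natrM !natr_prod -!big_split -prodf_div /=.
apply: eq_bigr => i _; rewrite /c invfM; field.
have ik := ltn_ord i; rewrite (gt_eqF lam0) !pnatr_eq0 -!lt0n !subn_gt0 /=.
by apply/andP; split; clear -ik km' kn' km kn; lia.
Qed.

(** Nonnegativity holds as [i / N <= i / (n - 1)], so lower bounds on [ell] may drop the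
    corrections; summed over [i < k], the upper bound is of order [k^2 / n + k^2 / m]. *)
Let ci_bounds i : (i < k)%N ->
  0 < c i /\ 0 <= ln (c i) <= 2 * (k%:R / n.-1%:R) + 2 * (k%:R / m%:R).
Proof.
move=> ik.
have i1 : (i <= N)%N by clear -kN kn ik; lia.
have i2 : (i < n.-1)%N by clear -kn ik; lia.
have i3 : (i < m)%N by clear -km ik; lia.
have N0 : 0 < N%:R :> R by rewrite ltr0n; clear -kN i2; lia.
pose a := i%:R / n.-1%:R : R; pose b := i%:R / m%:R : R; pose d := i%:R / N%:R : R.
have iR : 0 <= i%:R :> R by [].
have ikR : i%:R <= k%:R :> R by rewrite ler_nat ltnW.
have ab (X : R) : 0 < X -> 2 * k%:R <= X -> 0 <= i%:R / X <= 2^-1 /\ i%:R / X <= k%:R / X.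
  move=> X0 hX; rewrite divr_ge0 ?(ltW X0) // ler_pdivrMr // ler_pM2r ?invr_gt0 //.
  split => //=; lra.
have [/andP[a0 a1] a2] : 0 <= a <= 2^-1 /\ a <= k%:R / n.-1%:R.
  by apply: ab => //; rewrite -natrM ler_nat.
have [/andP[b0 b1] b2] : 0 <= b <= 2^-1 /\ b <= k%:R / m%:R.
  by apply: ab => //; rewrite -natrM ler_nat.
have d0 : 0 <= d by rewrite divr_ge0 // ltW.
have da : d <= a.
  by rewrite ler_wpM2l // lef_pV2 ?posrE // ler_nat.
have cE : c i = (1 - d) / ((1 - a) * (1 - b)).
  have h1 : (n.-1 - i)%:R = n.-1%:R * (1 - a) :> R.
    by rewrite natrB ?(ltnW i2) // /a; field; rewrite gt_eqF.
  have h2 : (m - i)%:R = m%:R * (1 - b) :> R.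
    by rewrite natrB ?(ltnW i3) // /b; field; rewrite gt_eqF.
  have h3 : (N - i)%:R = N%:R * (1 - d) :> R by rewrite natrB // /d; field; rewrite gt_eqF.
  rewrite /c h1 h2 h3 mulrA lamN.
  have : 1 - a != 0 by rewrite gt_eqF //; lra.
  have : 1 - b != 0 by rewrite gt_eqF //; lra.
  have ? := lt0r_neq0 K0; have ? := lt0r_neq0 mR0.
  by move=> ? ?; field; do ?[apply/andP; split].
have pa : 0 < 1 - a by lra.
have pb : 0 < 1 - b by lra.
have pd : 0 < 1 - d by lra.
have cpos : 0 < c i by rewrite cE divr_gt0 // mulr_gt0.
split => //; apply/andP; split.
  apply: ln_ge0; rewrite cE ler_pdivlMr ?mulr_gt0 // mul1r.
  apply: le_trans (_ : 1 - a <= _); last lra.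
  by rewrite ler_piMr //; lra.
rewrite cE ln_div ?posrE ?mulr_gt0 // lnM ?posrE //.
have na : `|- a| <= 2^-1 by rewrite normrN ger0_norm.
have nb : `|- b| <= 2^-1 by rewrite normrN ger0_norm.
have := norm_ln1D na; have := norm_ln1D nb; rewrite !normrN (ger0_norm a0) (ger0_norm b0).
have := @ln1D_le R (- d); rewrite !ler_norml => h /andP[h1 _] /andP[h2 _].
have {}h : ln (1 - d) <= - d by apply: h; lra.
lra.
Qed.

(** The linearisation of [ln ell] at [J = x], each [ln w] being replaced by [w - 1]. Its second
    term, about [k^2 / (2 lam)], is the one that must match [ln n]. *)
Let drift (x : R) : R := k%:R * ((x - lam) / lam) + k%:R * (k%:R + 1) / (2 * lam).

Let driftE x : drift x = \sum_(i < k) ((x + i.+1%:R) / lam - 1).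
Proof.
rewrite /drift (eq_bigr (fun i : 'I_k => ((x - lam) / lam) + lam^-1 * i.+1%:R)); last first.
  by move=> i _; field; rewrite gt_eqF.
rewrite big_split /= sumr_const card_ord -mulr_sumr sum_succ -[X in _ = X + _]mulr_natl.
by congr (_ + _); field; rewrite gt_eqF.
Qed.

Let ln_ellE j : ell R n m k (k + j) != 0 /\
  ln (ell R n m k (k + j)) = \sum_(i < k) (ln ((j + i.+1)%:R / lam) + ln (c i)).
Proof.
have p i : (i < k)%N -> 0 < (j + i.+1)%:R / lam * c i.
  move=> ik; have [c0 _] := ci_bounds ik.
  by rewrite mulr_gt0 // divr_gt0 // ltr0n addnS.
rewrite ell_prodE; split.
  by apply: lt0r_neq0; apply: prodr_gt0 => i _; apply: p.
rewrite (ln_prod (F := fun i => (j + i.+1)%:R / lam * c i)) //.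
apply: eq_bigr => i _; have [c0 _] := ci_bounds (ltn_ord i).
by rewrite lnM ?posrE // divr_gt0 // ltr0n addnS.
Qed.

Lemma ell_gt0 j : 0 < ell R n m k (k + j).
Proof. by have [h _] := ln_ellE j; rewrite lt0r h ell_ge0. Qed.

(** Concavity of the logarithm gives this for every [x], without any restriction to a neighbourhood
    of [lam]. *)
Lemma ln_ell_le j (x : R) : j%:R <= x ->
  ln (ell R n m k (k + j)) <=
  drift x + (2 * (k%:R ^+ 2 / n.-1%:R) + 2 * (k%:R ^+ 2 / m%:R)).
Proof.
move=> jx; have [_ ->] := ln_ellE j; rewrite big_split /=; apply: lerD.
  rewrite driftE; apply: ler_sum => i _.
  have y0 : 0 < (j + i.+1)%:R / lam by rewrite divr_gt0 // ltr0n addnS.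
  have := @ln1D_le R ((j + i.+1)%:R / lam - 1); rewrite addrCA subrr addr0.
  have -> : -1 < (j + i.+1)%:R / lam - 1 by lra.
  move=> /(_ isT)/le_trans; apply; rewrite lerD2r ler_pM2r ?invr_gt0 //.
  by rewrite natrD lerD2r.
have -> : 2 * (k%:R ^+ 2 / n.-1%:R) + 2 * (k%:R ^+ 2 / m%:R) =
  \sum_(i < k) (2 * (k%:R / n.-1%:R) + 2 * (k%:R / m%:R)) :> R.
  rewrite sumr_const card_ord -[RHS]mulr_natl; field.
  by rewrite !gt_eqF.
by apply: ler_sum => i _; have [_ /andP[]] := ci_bounds (ltn_ord i).
Qed.

(** Here the linearisation must be paid for: [V] bounds the deviation from 1 of all [k] factors at
    [x], each costing at most [2 V^2]. *)
Lemma ln_ell_ge j (x V : R) : x <= j%:R -> (`|x - lam| + k%:R) / lam <= V -> V <= 2^-1 ->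
  drift x - 2 * (k%:R * V ^+ 2) <= ln (ell R n m k (k + j)).
Proof.
move=> xj hV V1; have [_ ->] := ln_ellE j; rewrite driftE.
have -> : 2 * (k%:R * V ^+ 2) = \sum_(i < k) (2 * V ^+ 2).
  by rewrite sumr_const card_ord -[RHS]mulr_natl; ring.
rewrite -sumrB; apply: ler_sum => i _.
have [_ /andP[lc _]] := ci_bounds (ltn_ord i).
rewrite -[leLHS]addr0; apply: lerD => //.
set v := (x + i.+1%:R) / lam - 1.
have vV : `|v| <= V.
  apply: le_trans hV; have -> : v = (x - lam + i.+1%:R) / lam.
    by rewrite /v; field; rewrite gt_eqF.
  rewrite normrM [`|lam^-1|]gtr0_norm ?invr_gt0 // ler_pM2r ?invr_gt0 //.
  apply: le_trans (ler_normD _ _) _; rewrite lerD2l ger0_norm // ler_nat.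
  exact: ltn_ord.
have v1 : - 2^-1 <= v by move: vV; rewrite ler_norml => /andP[+ _]; lra.
have V2 : v ^+ 2 <= V ^+ 2.
  rewrite -[v ^+ 2]real_normK ?num_real //; apply: lerXn2r; rewrite ?nnegrE //.
  exact: le_trans vV.
apply: le_trans (_ : v - 2 * v ^+ 2 <= _); first by lra.
apply: le_trans (ln1D_ge v1) _.
have y0 : 0 < 1 + v by lra.
have y1 : 0 < (j + i.+1)%:R / lam by rewrite divr_gt0 // ltr0n addnS.
rewrite ler_ln ?posrE //.
have -> : 1 + v = (x + i.+1%:R) / lam by rewrite /v; ring.
by rewrite ler_pM2r ?invr_gt0 // natrD lerD2r.
Qed.

End LikelihoodRatio.

(** * Asymptotics of the likelihood ratio *)

Section SequenceTools.
Variable R : realType.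
Implicit Types f g : nat -> R.

Lemma near_cvg f g (l : R) : (\forall n \near \oo, f n = g n) ->
  g n @[n --> \oo] --> l -> f n @[n --> \oo] --> l.
Proof.
move=> fg; apply: cvg_trans; apply: near_eq_cvg.
by apply: filterS fg => n ->.
Qed.

Lemma seq_cvgM f g (a b : R) : f n @[n --> \oo] --> a -> g n @[n --> \oo] --> b ->
  f n * g n @[n --> \oo] --> a * b.
Proof. by move=> fa gb; apply: cvgM. Qed.

Lemma seq_cvgD f g (a b : R) : f n @[n --> \oo] --> a -> g n @[n --> \oo] --> b ->
  f n + g n @[n --> \oo] --> a + b.
Proof. by move=> fa gb; apply: cvgD. Qed.

Lemma seq_cvgZ f (a c : R) : f n @[n --> \oo] --> a -> c * f n @[n --> \oo] --> c * a.
Proof. by move=> fa; apply: seq_cvgM => //; exact: cvg_cst. Qed.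

Lemma seq_cvgDc f (a c : R) : f n @[n --> \oo] --> a -> f n + c @[n --> \oo] --> a + c.
Proof. by move=> fa; apply: seq_cvgD => //; exact: cvg_cst. Qed.

Lemma seq_cvgV f (a : R) : a != 0 -> f n @[n --> \oo] --> a -> (f n)^-1 @[n --> \oo] --> a^-1.
Proof. by move=> a0 fa; apply: cvgV. Qed.

Lemma seq_cvg_sqrt f (a : R) : f n @[n --> \oo] --> a ->
  Num.sqrt (f n) @[n --> \oo] --> Num.sqrt a.
Proof. by move=> fa; apply: continuous_cvg => //; exact: sqrt_continuous. Qed.

Lemma near_squeeze0 f g : (\forall n \near \oo, `|f n| <= g n) ->
  g n @[n --> \oo] --> (0 : R) -> f n @[n --> \oo] --> (0 : R).
Proof.
move=> fg /cvgrPdist_le hg; apply/cvgrPdist_le => e e0; near=> n.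
rewrite sub0r normrN; apply: le_trans (_ : g n <= _); first by near: n.
have : `|0 - g n| <= e by near: n; exact: hg.
by rewrite sub0r normrN; apply: le_trans; apply: ler_norm.
Unshelve. all: by end_near.
Qed.

Lemma near_le_cst f (l c : R) : f n @[n --> \oo] --> l -> l < c -> \forall n \near \oo, f n <= c.
Proof.
move=> /cvgrPdist_le h lc; have d0 : 0 < c - l by rewrite subr_gt0.
near=> n; have : `|l - f n| <= c - l by near: n; exact: h.
by rewrite ler_norml => /andP[h1 _]; lra.
Unshelve. all: by end_near.
Qed.

Lemma near_ge_cst f (l c : R) : f n @[n --> \oo] --> l -> c < l -> \forall n \near \oo, c <= f n.
Proof.
move=> /cvgrPdist_le h lc; have d0 : 0 < l - c by rewrite subr_gt0.
near=> n; have : `|l - f n| <= l - c by near: n; exact: h.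
by rewrite ler_norml => /andP[_ h1]; lra.
Unshelve. all: by end_near.
Qed.

Lemma cvg_lny : ln (n%:R : R) @[n --> \oo] --> +oo.
Proof.
apply/cvgryPge => A; near=> n.
have h : expR A <= n%:R by near: n; exact: nbhs_infty_ger.
rewrite -[A]expRK ler_ln ?posrE ?expR_gt0 //; exact: lt_le_trans (expR_gt0 A) h.
Unshelve. all: by end_near.
Qed.

Lemma cvgV0 f : f n @[n --> \oo] --> +oo -> (f n)^-1 @[n --> \oo] --> (0 : R).
Proof.
move=> /cvgryPge h; apply/cvgrPdist_le => e e0; near=> n.
have he : e^-1 <= f n by near: n; exact: h.
have f0 : 0 < f n by apply: lt_le_trans he; rewrite invr_gt0.
rewrite sub0r normrN gtr0_norm ?invr_gt0 //.
by rewrite -[leRHS]invrK lef_pV2 ?posrE ?invr_gt0.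
Unshelve. all: by end_near.
Qed.

Lemma near_ge_cvgy f g : (\forall n \near \oo, g n <= f n) ->
  g n @[n --> \oo] --> +oo -> f n @[n --> \oo] --> +oo.
Proof.
move=> h /cvgryPge hg; apply/cvgryPge => A; near=> n.
apply: le_trans (_ : g n <= _); near: n => //; exact: hg.
Unshelve. all: by end_near.
Qed.

End SequenceTools.

Section Asymptotics.
Variables (R : realType) (k m : nat -> nat) (gamma : R).
Hypothesis k_gt0 : forall n, (0 < k n)%N.
Hypothesis log_k : (fun n => ln (n%:R : R) ^+ 2 / (k n)%:R) @ \oo --> (0 : R).
Hypothesis k_sqrt : (fun n => (k n)%:R / Num.sqrt (n%:R : R)) @ \oo --> (0 : R).
Hypothesis m_near : \forall n \near \oo,
     `|(m n)%:R - ((k n)%:R ^+ 2 * n%:R / (4 * ln (n%:R : R)))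
                   * (1 + gamma / Num.sqrt (ln (n%:R : R)))| < 1.

Let l n : R := ln n%:R.
Let sl n : R := Num.sqrt (l n).
Let kR n : R := (k n)%:R.
Let mR n : R := (m n)%:R.
Let nR n : R := n%:R.
Let lam n : R := 2 * mR n / nR n.
Let y n : R := 4 * mR n * l n / (nR n * kR n ^+ 2).
Let p n : R := mR n / 'C(n, 2)%:R.
(** [A] and [B] measure the total corrections for sampling without replacement. *)
Let A n : R := kR n ^+ 2 / n.-1%:R.
Let B n : R := kR n ^+ 2 / mR n.
Let mu n : R := (n.-1 - k n)%:R * (m n - k n)%:R / (n.-1 - k n + ('C(n, 2) - n.-1))%:R.

Let l_ge1 : \forall n \near \oo, 1 <= l n.
Proof. by have /cvgryPge := @cvg_lny R; apply. Qed.

Let n_big (j : nat) : \forall n \near \oo, (j < n)%N.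
Proof. exact: nbhs_infty_gt. Qed.

Let kR1 n : 1 <= kR n. Proof. by rewrite /kR ler1n. Qed.

Let l_lek : \forall n \near \oo, l n ^+ 2 <= kR n.
Proof.
have h := near_le_cst log_k ltr01; near=> n.
have : l n ^+ 2 / kR n <= 1 by near: n.
by rewrite ler_pdivrMr ?mul1r // (lt_le_trans ltr01).
Unshelve. all: by end_near.
Qed.

Let k2n : kR n ^+ 2 / nR n @[n --> \oo] --> (0 : R).
Proof.
have h := seq_cvgM k_sqrt k_sqrt; rewrite mulr0 in h; apply: (near_cvg _ h); near=> n.
rewrite /= -expr2 expr_div_n sqr_sqrtr //.
Unshelve. all: by end_near.
Qed.

Let A0 : A n @[n --> \oo] --> (0 : R).
Proof.
have h : 2 * (kR n ^+ 2 / nR n) @[n --> \oo] --> (0 : R).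
  by rewrite -[0](mulr0 (2 : R)); exact: seq_cvgZ k2n.
apply: near_squeeze0 h; near=> n.
have n2 : (1 < n)%N by near: n.
have n0 : 0 < nR n by rewrite ltr0n ltnW.
have n10 : 0 < n.-1%:R :> R by rewrite ltr0n; lia.
rewrite ger0_norm ?divr_ge0 ?sqr_ge0 // /A ler_pdivrMr //.
have -> : 2 * (kR n ^+ 2 / nR n) * n.-1%:R = kR n ^+ 2 * ((2 * n.-1%:R) / nR n).
  by field; rewrite gt_eqF.
by rewrite ler_peMr ?sqr_ge0 // ler_pdivlMr // mul1r -natrM ler_nat; lia.
Unshelve. all: by end_near.
Qed.

Let ln0 : l n / nR n @[n --> \oo] --> (0 : R).
Proof.
apply: near_squeeze0 k2n; near=> n.
have n0 : 0 < nR n by rewrite ltr0n; near: n.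
have h1 : 1 <= l n by near: n.
have h2 : l n ^+ 2 <= kR n by near: n.
rewrite ger0_norm ?divr_ge0 //; last lra.
rewrite ler_pM2r ?invr_gt0 //; have k1 := kR1 n.
apply: le_trans (_ : l n ^+ 2 <= _); first by rewrite expr2 ler_peMr //; lra.
by apply: le_trans h2 _; rewrite expr2 ler_peMr //; lra.
Unshelve. all: by end_near.
Qed.

Let sly : sl n * (y n - 1) @[n --> \oo] --> gamma.
Proof.
suff h : sl n * (y n - 1) - gamma @[n --> \oo] --> (0 : R).
  have h' := seq_cvgDc (c := gamma) h; rewrite add0r in h'.
  by apply: (near_cvg _ h'); near=> n => /=; rewrite subrK.
(* Rounding moves [m] by less than 1, hence [sl * y] by at most [sl * 4 l / (n k^2)], which is below
   [4 l^2 / k]. *)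
have h4 : 4 * (l n ^+ 2 / kR n) @[n --> \oo] --> (0 : R).
  by rewrite -[0](mulr0 (4 : R)); exact: seq_cvgZ log_k.
apply: near_squeeze0 h4; near=> n.
have n1 : 1 <= nR n by rewrite ler1n; near: n.
have h1 : 1 <= l n by near: n.
have k1 := kR1 n.
have l0 : 0 < l n by lra.
have s0 : 0 < sl n by rewrite sqrtr_gt0.
have sE : sl n ^+ 2 = l n by rewrite sqr_sqrtr // ltW.
have hm : `|mR n - (kR n ^+ 2 * nR n / (4 * l n)) * (1 + gamma / sl n)| <= 1.
  by apply: ltW; near: n.
have -> : sl n * (y n - 1) - gamma = (sl n * (4 * l n / (nR n * kR n ^+ 2))) *
    (mR n - (kR n ^+ 2 * nR n / (4 * l n)) * (1 + gamma / sl n)).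
  rewrite /y; field; rewrite !gt_eqF //; lra.
have c0 : 0 <= sl n * (4 * l n / (nR n * kR n ^+ 2)).
  rewrite mulr_ge0 ?(ltW s0) // divr_ge0 ?mulr_ge0 ?sqr_ge0 //; lra.
rewrite normrM (ger0_norm c0); apply: le_trans (ler_wpM2l c0 hm) _; rewrite mulr1.
have s1 : sl n <= l n.
  by rewrite -[leRHS]sE expr2 ler_peMl ?(ltW s0) // -sqrtr1 ler_wsqrtr.
have -> : 4 * (l n ^+ 2 / kR n) = l n * (4 * l n / kR n) by field; rewrite gt_eqF //; lra.
apply: ler_pM => //; first exact: ltW.
  by rewrite divr_ge0 ?mulr_ge0 ?sqr_ge0 //; lra.
rewrite ler_wpM2l ?mulr_ge0 //; first lra.
rewrite lef_pV2 ?posrE ?mulr_gt0 ?exprn_gt0 //; try lra.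
have : 1 * kR n <= nR n * kR n ^+ 2.
  by apply: ler_pM => //; rewrite expr2 ler_peMr //; lra.
by rewrite mul1r.
Unshelve. all: by end_near.
Qed.

Let sl0 : (sl n)^-1 @[n --> \oo] --> (0 : R).
Proof.
have h := cvgV0 (@cvg_lny R).
have h' := seq_cvg_sqrt h; rewrite sqrtr0 in h'.
apply: (near_cvg _ h'); near=> n; rewrite sqrtrV // ln_ge0 // ler1n; near: n.
Unshelve. all: by end_near.
Qed.

Let y1 : y n @[n --> \oo] --> (1 : R).
Proof.
have h := seq_cvgDc (c := 1) (seq_cvgM sly sl0); rewrite mulr0 add0r in h.
apply: (near_cvg _ h); near=> n => /=.
have h1 : 1 <= l n by near: n.
have s0 : sl n != 0 by rewrite gt_eqF // sqrtr_gt0; lra.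
by rewrite mulrAC divff // mul1r subrK.
Unshelve. all: by end_near.
Qed.

Let y_ge : \forall n \near \oo, 2^-1 <= y n.
Proof. by apply: (near_ge_cst y1); rewrite invf_lt1 // ltr1n. Qed.

Let lamE : \forall n \near \oo, [/\ 0 < nR n, 1 <= l n, 2^-1 <= y n, 0 < lam n &
  lam n = kR n ^+ 2 * y n / (2 * l n)].
Proof.
near=> n.
have n0 : 0 < nR n by rewrite ltr0n; near: n.
have l1 : 1 <= l n by near: n.
have yh : 2^-1 <= y n by near: n.
have k1 := kR1 n.
have e : lam n = kR n ^+ 2 * y n / (2 * l n).
  by rewrite /lam /y; field; rewrite !gt_eqF //; lra.
have k0 : 0 < kR n by lra.
have y0 : 0 < y n by lra.
have l0 : 0 < 2 * l n by lra.
by split => //; rewrite e (divr_gt0 (mulr_gt0 (exprn_gt0 2 k0) y0) l0).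
Unshelve. all: by end_near.
Qed.

Let m_gt0 : \forall n \near \oo, 0 < mR n.
Proof.
near=> n.
have [n0 _ _ lam0 _] : [/\ 0 < nR n, 1 <= l n, 2^-1 <= y n, 0 < lam n &
  lam n = kR n ^+ 2 * y n / (2 * l n)] by near: n.
have -> : mR n = lam n * nR n / 2 by rewrite /lam; field; rewrite gt_eqF.
by rewrite divr_gt0 // mulr_gt0.
Unshelve. all: by end_near.
Qed.

Let yV : (y n)^-1 @[n --> \oo] --> (1 : R).
Proof. by have h := seq_cvgV (oner_neq0 R) y1; rewrite invr1 in h. Qed.

Let B0 : B n @[n --> \oo] --> (0 : R).
Proof.
have h := seq_cvgM (seq_cvgZ (c := 4) ln0) yV; rewrite mulr0 mul0r in h.
apply: (near_cvg _ h); near=> n.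
have [n0 l1 yh lam0 _] : [/\ 0 < nR n, 1 <= l n, 2^-1 <= y n, 0 < lam n &
  lam n = kR n ^+ 2 * y n / (2 * l n)] by near: n.
have k1 := kR1 n; have m1 : 0 < mR n by near: n.
by rewrite /B /y; field; rewrite !gt_eqF //; lra.
Unshelve. all: by end_near.
Qed.

Let lV0 : (l n)^-1 @[n --> \oo] --> (0 : R).
Proof. exact: cvgV0 (@cvg_lny R). Qed.

Let bin2E n : (1 < n)%N -> nR n * n.-1%:R = 2 * 'C(n, 2)%:R.
Proof.
by move=> _; rewrite -!natrM; congr (_%:R); rewrite -[RHS](mul_bin_diag n 1) bin1.
Qed.

Let n1_gt0 n : (1 < n)%N -> 0 < n.-1%:R :> R.
Proof. by move=> n1; rewrite ltr0n -subn1 subn_gt0. Qed.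

Let pE n : (1 < n)%N -> p n = lam n / n.-1%:R.
Proof.
move=> n1; have := bin2E n1; have n10 := n1_gt0 n1.
have n0 : 0 < nR n by rewrite ltr0n ltnW.
move=> e; have -> : p n = 2 * mR n / (2 * 'C(n, 2)%:R).
  by rewrite /p -mulf_div divff ?mul1r // pnatr_eq0.
by rewrite -e /lam; field; rewrite !gt_eqF.
Qed.

Let p0 : p n @[n --> \oo] --> (0 : R).
Proof.
have h := seq_cvgM (seq_cvgM A0 y1) (seq_cvgZ (c := 2^-1) lV0); rewrite mul0r mul0r in h.
apply: (near_cvg _ h); near=> n.
have n1 : (1 < n)%N by near: n.
have [n0 l1 _ _ e] : [/\ 0 < nR n, 1 <= l n, 2^-1 <= y n, 0 < lam n &
  lam n = kR n ^+ 2 * y n / (2 * l n)] by near: n.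
rewrite pE // e /A; have := n1_gt0 n1 => n10.
by field; rewrite !gt_eqF //; lra.
Unshelve. all: by end_near.
Qed.

Lemma near_sizes : \forall n \near \oo,
  [/\ (1 < n)%N, (2 * k n <= n.-1)%N, (2 * k n <= m n)%N, (0 < m n)%N & (m n < 'C(n, 2))%N].
Proof.
have h2 : 0 < 2^-1 :> R by rewrite invr_gt0.
have hA := near_le_cst A0 h2; have hB := near_le_cst B0 h2.
have hp := near_le_cst p0 (@ltr01 R).
have hp' := near_le_cst p0 h2.
near=> n.
have n1 : (1 < n)%N by near: n.
have m1 : 0 < mR n by near: n.
have k1 := kR1 n; have n10 := n1_gt0 n1.
have kk : kR n <= kR n ^+ 2 by rewrite expr2 ler_peMr // (le_trans ler01).
have a1 : A n <= 2^-1 by near: n.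
have b1 : B n <= 2^-1 by near: n.
have p1 : p n <= 2^-1 by near: n.
have N0 : 0 < 'C(n, 2)%:R :> R by rewrite ltr0n bin_gt0.
split => //; last 1 first.
- rewrite -(ltr_nat R); rewrite /p ler_pdivrMr // in p1; move: p1; rewrite -/(mR n); lra.
- rewrite -(ler_nat R) natrM; rewrite /A ler_pdivrMr // in a1; rewrite -/(kR n); lra.
- rewrite -(ler_nat R) natrM; rewrite /B ler_pdivrMr // in b1; rewrite -/(kR n) -/(mR n); lra.
- by move: m1; rewrite ltr0n.
Unshelve. all: by end_near.
Qed.

Let rho n := mu n / lam n.

(** The drift multiplies the relative error [1 - rho] of the mean by [k], so the bound must be small
    even after division by [1 / k]; this is why [k] stands in the denominator. *)
Let rho_bounds : \forall n \near \oo, 1 - rho n <= (A n + B n) / kR n /\ 0 < rho n <= 1.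
Proof.
near=> n.
have [n1 kn km m0 mN] : [/\ (1 < n)%N, (2 * k n <= n.-1)%N, (2 * k n <= m n)%N,
  (0 < m n)%N & (m n < 'C(n, 2))%N] by near: n; exact: near_sizes.
have nN := leq_pred_bin2 n.
have K0 := n1_gt0 n1; have k1 := kR1 n.
have m1 : 0 < mR n by rewrite ltr0n.
have n0 : 0 < nR n by rewrite ltr0n ltnW.
have N0 : 0 < 'C(n, 2)%:R :> R by rewrite ltr0n bin_gt0.
pose a := kR n / n.-1%:R; pose b := kR n / mR n; pose d := kR n / 'C(n, 2)%:R : R.
have a1 : a <= 2^-1.
  by rewrite ler_pdivrMr //; move: kn; rewrite -(ler_nat R) natrM -/(kR n); lra.
have b1 : b <= 2^-1.
  by rewrite ler_pdivrMr //; move: km; rewrite -(ler_nat R) natrM -/(kR n) -/(mR n); lra.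
have kR0 : 0 < kR n by lra.
have a0 : 0 < a by rewrite divr_gt0.
have b0 : 0 < b by rewrite divr_gt0.
have d0 : 0 < d by rewrite divr_gt0.
have da : d <= a by rewrite ler_wpM2l ?(ltW kR0) // lef_pV2 ?posrE // ler_nat.
have rE : rho n = (1 - a) * (1 - b) / (1 - d).
  have e1 : (n.-1 - k n)%:R = n.-1%:R * (1 - a).
    rewrite natrB; last by clear -kn; lia.
    by rewrite /a /kR; field; rewrite gt_eqF.
  have e2 : (m n - k n)%:R = mR n * (1 - b).
    rewrite natrB; last by clear -km; lia.
    by rewrite /b /kR -/(mR n); field; rewrite gt_eqF.
  have e3 : (n.-1 - k n + ('C(n, 2) - n.-1))%:R = 'C(n, 2)%:R * (1 - d).
    have -> : (n.-1 - k n + ('C(n, 2) - n.-1) = 'C(n, 2) - k n)%N by clear -kn nN; lia.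
    rewrite natrB; last by clear -kn nN; lia.
    by rewrite /d /kR; field; rewrite gt_eqF.
  have dd : 1 - d != 0 by rewrite gt_eqF //; lra.
  rewrite /rho /mu e1 e2 e3 /lam.
  have -> : 'C(n, 2)%:R = nR n * n.-1%:R / 2 by rewrite bin2E //; field.
  by field; rewrite dd !gt_eqF.
have pd : 0 < 1 - d by lra.
have pa : 0 < 1 - a by lra.
have pb : 0 < 1 - b by lra.
have -> : (A n + B n) / kR n = a + b by rewrite /A /B /a /b; field; rewrite !gt_eqF.
split.
  rewrite lerBlDr -lerBlDl; apply: le_trans (_ : (1 - a) * (1 - b) <= _).
    have ab : 0 <= a * b by rewrite mulr_ge0 ?(ltW a0) ?(ltW b0).
    rewrite (_ : (1 - a) * (1 - b) = 1 - (a + b) + a * b) ?lerDl //; ring.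
  by rewrite rE ler_pdivlMr // ler_piMr ?mulr_ge0 ?ltW //; lra.
rewrite rE divr_gt0 ?mulr_gt0 //= ler_pdivrMr // mul1r.
apply: le_trans (_ : 1 - a <= _); last lra.
by rewrite ler_piMr //; lra.
Unshelve. all: by end_near.
Qed.

(** Eventually [mu >= lam / 2], and [lam >= k^2 / (4 ln n) >= ln n / 4] because [k >= (ln n)^2]. *)
Lemma mean_cvgy : mu n @[n --> \oo] --> +oo.
Proof.
have h : 8^-1 * l n @[n --> \oo] --> +oo.
  apply/cvgryPge => a; near=> n.
  have : 8 * a <= l n by near: n; have /cvgryPge := @cvg_lny R; apply.
  by rewrite ler_pdivlMl.
have r1 : \forall n \near \oo, 1 - rho n <= 2^-1.
  have hAB := seq_cvgD A0 B0; rewrite addr0 in hAB.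
  have h2 : 0 < 2^-1 :> R by rewrite invr_gt0.
  have := near_le_cst hAB h2 => hAB2.
  near=> n; have [h1 _] : 1 - rho n <= (A n + B n) / kR n /\ 0 < rho n <= 1 by near: n.
  have hh : A n + B n <= 2^-1 by near: n.
  apply: le_trans h1 (le_trans _ hh); have k1 := kR1 n.
  rewrite ler_pdivrMr ?(lt_le_trans ltr01) // ler_peMr //.
  by rewrite addr_ge0 // divr_ge0 ?sqr_ge0.
apply: near_ge_cvgy h; near=> n.
have [n0 l1 yh lam0 e] : [/\ 0 < nR n, 1 <= l n, 2^-1 <= y n, 0 < lam n &
  lam n = kR n ^+ 2 * y n / (2 * l n)] by near: n.
have hr : 1 - rho n <= 2^-1 by near: n.
have hl : l n ^+ 2 <= kR n by near: n.
have k1 := kR1 n.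
have l2 : l n ^+ 2 <= kR n ^+ 2.
  by apply: le_trans hl _; rewrite expr2 ler_peMr //; lra.
have -> : mu n = rho n * lam n by rewrite /rho mulfVK // gt_eqF.
apply: le_trans (_ : 2^-1 * lam n <= _); last first.
  by rewrite ler_pM2r //; lra.
have -> : 8^-1 * l n = 2^-1 * (l n / 4) by field.
rewrite ler_pM2l ?invr_gt0 // e ler_pdivlMr; last lra.
have -> : l n / 4 * (2 * l n) = l n ^+ 2 * 2^-1 by field.
by apply: ler_pM => //; rewrite ?sqr_ge0 ?invr_ge0.
Unshelve. all: by end_near.
Qed.

Let drift (x : R) n := kR n * ((x - lam n) / lam n) + kR n * (kR n + 1) / (2 * lam n).

Let lk0 : l n / kR n @[n --> \oo] --> (0 : R).
Proof.
apply: near_squeeze0 log_k; near=> n.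
have l1 : 1 <= l n by near: n.
have k1 := kR1 n.
rewrite ger0_norm ?divr_ge0 //; try lra.
by rewrite ler_pM2r ?invr_gt0 ?(lt_le_trans ltr01) // expr2 ler_peMr //; lra.
Unshelve. all: by end_near.
Qed.

Let krho0 : kR n * (1 - rho n) @[n --> \oo] --> (0 : R).
Proof.
have hAB := seq_cvgD A0 B0; rewrite addr0 in hAB.
apply: near_squeeze0 hAB; near=> n.
have [h1 /andP[_ h2]] : 1 - rho n <= (A n + B n) / kR n /\ 0 < rho n <= 1 by near: n.
have k1 := kR1 n.
rewrite ger0_norm ?mulr_ge0 //; try lra.
by rewrite mulrC -ler_pdivlMr // (lt_le_trans ltr01).
Unshelve. all: by end_near.
Qed.

Let rho1 : rho n @[n --> \oo] --> (1 : R).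
Proof.
have h : 1 - rho n @[n --> \oo] --> (0 : R).
  have hAB := seq_cvgD A0 B0; rewrite addr0 in hAB.
  apply: near_squeeze0 hAB; near=> n.
  have [h1 /andP[_ h2]] : 1 - rho n <= (A n + B n) / kR n /\ 0 < rho n <= 1 by near: n.
  have k1 := kR1 n.
  rewrite ger0_norm; last lra.
  apply: le_trans h1 _; rewrite ler_pdivrMr ?(lt_le_trans ltr01) // ler_peMr //.
  by rewrite addr_ge0 // divr_ge0 ?sqr_ge0.
have h' := seq_cvgDc (c := 1) (seq_cvgZ (c := -1) h); rewrite mulr0 add0r in h'.
by apply: (near_cvg _ h'); near=> n; ring.
Unshelve. all: by end_near.
Qed.

Variable z : R.

Let x n := mu n + z * Num.sqrt (mu n).

(* With [y = 4 m ln n / (n k^2)], so that [k^2 / (2 lam) = ln n / y], the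
   hypothesis on [m] reads [sqrt (ln n) (y - 1) --> gamma]. *)
Let drift_cvg : (drift (x n) n - l n) / sl n @[n --> \oo] --> z * Num.sqrt 2 - gamma.
Proof.
(* In order: the error in the mean of [J], the Gaussian fluctuation, the offset of [m] giving
   [- gamma], and the difference between [k (k + 1)] and [k^2]. *)
have t1 := seq_cvgM (seq_cvgZ (c := -1) krho0) sl0.
have t2 := seq_cvgZ (c := z) (seq_cvg_sqrt (seq_cvgZ (c := 2) (seq_cvgM rho1 yV))).
have t3 := seq_cvgZ (c := -1) (seq_cvgM sly yV).
have t4 := seq_cvgM (seq_cvgM lk0 yV) sl0.
have h := seq_cvgD (seq_cvgD t1 t2) (seq_cvgD t3 t4).
rewrite mulr0 !mul0r !mulr1 addr0 add0r mulN1r in h.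
apply: (near_cvg _ h); near=> n.
have [n0 l1 yh lam0 e] : [/\ 0 < nR n, 1 <= l n, 2^-1 <= y n, 0 < lam n &
  lam n = kR n ^+ 2 * y n / (2 * l n)] by near: n.
have [_ /andP[r0 _]] : 1 - rho n <= (A n + B n) / kR n /\ 0 < rho n <= 1 by near: n.
have k1 := kR1 n; have k0 : 0 < kR n by lra.
have y0 : 0 < y n by lra.
have l0 : 0 < l n by lra.
have s0 : 0 < sl n by rewrite sqrtr_gt0.
have sE : sl n ^+ 2 = l n by rewrite sqr_sqrtr // ltW.
have muE : mu n = rho n * lam n by rewrite /rho mulfVK // gt_eqF.
have mu0 : 0 < mu n by rewrite muE mulr_gt0.
have e2 : Num.sqrt (2 * (rho n * (y n)^-1)) = kR n * Num.sqrt (mu n) / (lam n * sl n).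
  have pos : 0 <= kR n * Num.sqrt (mu n) / (lam n * sl n).
    apply: divr_ge0; first by rewrite (mulr_ge0 (ltW k0) (sqrtr_ge0 _)).
    by rewrite (mulr_ge0 (ltW lam0) (ltW s0)).
  rewrite -[RHS]ger0_norm // -sqrtr_sqr; congr (Num.sqrt _).
  have el : lam n * l n = kR n ^+ 2 * y n / 2.
    by rewrite e; move: k0 y0 l0; move: (kR n) (y n) (l n) => a b c a0 b0 c0; field; rewrite gt_eqF.
  transitivity (rho n * (kR n ^+ 2 / (lam n * l n))).
    rewrite el; move: k0 y0; move: (kR n) (y n) (rho n) => a b c a0 b0.
    by field; rewrite !gt_eqF.
  rewrite !exprMn exprVn exprMn sE sqr_sqrtr ?(ltW mu0) // muE; move: lam0 l0 k0.
  by move: (lam n) (l n) (kR n) (rho n) => a b c d a0 b0 c0; field; rewrite !gt_eqF.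
rewrite e2 /drift /x.
have -> : kR n * ((mu n + z * Num.sqrt (mu n) - lam n) / lam n) +
   kR n * (kR n + 1) / (2 * lam n) - l n =
   - (kR n * (1 - rho n)) + z * (kR n * Num.sqrt (mu n) / lam n) +
   (- (l n * (y n - 1) / y n) + l n / (kR n * y n)).
  rewrite {1}muE.
  have -> : kR n * (kR n + 1) / (2 * lam n) = l n / y n + l n / (kR n * y n).
    by rewrite e; move: k0 y0 l0; move: (kR n) (y n) (l n) => a b c a0 b0 c0; field; rewrite !gt_eqF.
  move: lam0 k0 y0; move: (Num.sqrt _) (lam n) (kR n) (y n) (l n) (rho n) => w a b c d r a0 b0 c0.
  by field; rewrite !gt_eqF.
rewrite -{1}sE; move: s0 lam0 k0 y0.
move: (Num.sqrt (mu n)) (sl n) (lam n) (kR n) (y n) (rho n) (l n) => w s a b c r d s0 a0 b0 c0.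
by field; rewrite !gt_eqF.
Unshelve. all: by end_near.
Qed.

Let V n := 1 - rho n + `|z| * (Num.sqrt (mu n) / lam n) + kR n / lam n.

(** The square of the last summand of [V], times [k], is [4 (ln n)^2 / (k y^2)]: here the growth of
    [k] beyond [(ln n)^2] is essential. *)
Let kV0 : kR n * V n ^+ 2 @[n --> \oo] --> (0 : R).
Proof.
have t2 := seq_cvgZ (c := 2 * z ^+ 2) (seq_cvgM lk0 yV).
have t3 := seq_cvgZ (c := 4) (seq_cvgM log_k (seq_cvgM yV yV)).
have h := seq_cvgZ (c := 3) (seq_cvgD (seq_cvgD krho0 t2) t3).
rewrite !mul0r !mulr0 !addr0 mulr0 in h.
apply: near_squeeze0 h; near=> n.
have [n0 l1 yh lam0 e] : [/\ 0 < nR n, 1 <= l n, 2^-1 <= y n, 0 < lam n &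
  lam n = kR n ^+ 2 * y n / (2 * l n)] by near: n.
have [_ /andP[r0 r1]] : 1 - rho n <= (A n + B n) / kR n /\ 0 < rho n <= 1 by near: n.
have k1 := kR1 n; have k0 : 0 < kR n by lra.
have y0 : 0 < y n by lra.
have l0 : 0 < l n by lra.
have muE : mu n = rho n * lam n by rewrite /rho mulfVK // gt_eqF.
have mu0 : 0 < mu n by rewrite muE mulr_gt0.
have kV : 0 <= kR n * V n ^+ 2 by rewrite (mulr_ge0 (ltW k0) (sqr_ge0 _)).
rewrite ger0_norm // /V.
have b1 : kR n * (1 - rho n) ^+ 2 <= kR n * (1 - rho n).
  rewrite ler_pM2l // expr2; apply: ler_piMl; lra.
have b2 : kR n * (`|z| * (Num.sqrt (mu n) / lam n)) ^+ 2 <=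
    2 * z ^+ 2 * (l n / kR n * (y n)^-1).
  rewrite exprMn real_normK ?num_real // expr_div_n sqr_sqrtr ?(ltW mu0) // muE.
  have -> : kR n * (z ^+ 2 * (rho n * lam n / lam n ^+ 2)) = z ^+ 2 * (rho n * (kR n / lam n)).
    by move: lam0; move: (lam n) (kR n) (rho n) => a b c a0; field; rewrite gt_eqF.
  have -> : 2 * z ^+ 2 * (l n / kR n * (y n)^-1) = z ^+ 2 * (kR n / lam n).
    by rewrite e; move: l0 k0 y0; move: (l n) (kR n) (y n) => a b c a0 b0 c0; field; rewrite !gt_eqF.
  rewrite ler_wpM2l ?sqr_ge0 //; apply: ler_piMl => //.
  exact: divr_ge0 (ltW k0) (ltW lam0).
have b3 : kR n * (kR n / lam n) ^+ 2 = 4 * (l n ^+ 2 / kR n * ((y n)^-1 * (y n)^-1)).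
  by rewrite e; move: l0 k0 y0; move: (l n) (kR n) (y n) => a b c a0 b0 c0; field; rewrite !gt_eqF.
have sq3 (a b c : R) : (a + b + c) ^+ 2 <= 3 * (a ^+ 2 + b ^+ 2 + c ^+ 2).
  have := sqr_ge0 (a - b); have := sqr_ge0 (b - c); have := sqr_ge0 (a - c).
  rewrite !expr2; lra.
apply: le_trans (ler_wpM2l (ltW k0) (sq3 _ _ _)) _.
rewrite mulrCA ler_pM2l // (mulrDr (kR n) (_ + _)) (mulrDr (kR n) (_ ^+ 2)).
apply: lerD; first exact: lerD.
by rewrite b3.
Unshelve. all: by end_near.
Qed.

(** After division by [sqrt (ln n)], the constant [ln eps] and the corrections vanish while the
    drift keeps a strictly negative limit. *)
Lemma near_ell_le (eps : R) : z * Num.sqrt 2 < gamma -> 0 < eps ->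
  \forall n \near \oo, forall j, j%:R <= mu n + z * Num.sqrt (mu n) ->
    ell R n (m n) (k n) (k n + j) <= eps * n%:R.
Proof.
move=> zg e0.
have AB := seq_cvgDc (c := - ln eps) (seq_cvgD (seq_cvgZ (c := 2) A0) (seq_cvgZ (c := 2) B0)).
have h := seq_cvgD drift_cvg (seq_cvgM AB sl0); rewrite mulr0 addr0 in h.
have neg : z * Num.sqrt 2 - gamma < 0 by rewrite subr_lt0.
have h0 := near_le_cst h neg; near=> n => j hj.
have [n1 kn km m0 mN] : [/\ (1 < n)%N, (2 * k n <= n.-1)%N, (2 * k n <= m n)%N,
  (0 < m n)%N & (m n < 'C(n, 2))%N] by near: n; exact: near_sizes.
have l1 : 1 <= l n by near: n.
have s0 : 0 < sl n by rewrite sqrtr_gt0; lra.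
have n0 : 0 < n%:R :> R by rewrite ltr0n ltnW.
have hh : (drift (x n) n - l n) / sl n + (2 * A n + 2 * B n - ln eps) * (sl n)^-1 <= 0.
  by near: n.
rewrite -mulrDl pmulr_lle0 ?invr_gt0 // in hh.
have ell0 := @ell_gt0 R n (m n) (k n) n1 kn km m0 (ltnW mN) j.
have cn0 := (mulr_gt0 e0 n0).
rewrite -ler_ln ?posrE // lnM ?posrE //.
apply: le_trans (ln_ell_le n1 kn km m0 (ltnW mN) hj) _.
move: hh; rewrite /drift /x /A /B /lam /l /kR /mR /nR; lra.
Unshelve. all: by end_near.
Qed.

Lemma near_ell_gt (C : R) : gamma < z * Num.sqrt 2 -> 0 < C ->
  \forall n \near \oo, forall j, mu n + z * Num.sqrt (mu n) <= j%:R ->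
    C * n%:R < ell R n (m n) (k n) (k n + j).
Proof.
move=> zg C0.
have AB := seq_cvgDc (c := - ln C) (seq_cvgZ (c := - 2) kV0).
have h := seq_cvgD drift_cvg (seq_cvgM AB sl0); rewrite mulr0 addr0 in h.
have pos : (z * Num.sqrt 2 - gamma) / 2 < z * Num.sqrt 2 - gamma by lra.
have h0 := near_ge_cst h pos.
have q0 : 0 < 4^-1 :> R by rewrite invr_gt0.
have hV := near_le_cst kV0 q0; near=> n => j hj.
have [n1 kn km m0 mN] : [/\ (1 < n)%N, (2 * k n <= n.-1)%N, (2 * k n <= m n)%N,
  (0 < m n)%N & (m n < 'C(n, 2))%N] by near: n; exact: near_sizes.
have [_ l1 _ lam0 _] : [/\ 0 < nR n, 1 <= l n, 2^-1 <= y n, 0 < lam n &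
  lam n = kR n ^+ 2 * y n / (2 * l n)] by near: n.
have [_ /andP[r0 r1]] : 1 - rho n <= (A n + B n) / kR n /\ 0 < rho n <= 1 by near: n.
have s0 : 0 < sl n by rewrite sqrtr_gt0; lra.
have n0 : 0 < n%:R :> R by rewrite ltr0n ltnW.
have k1 := kR1 n.
have hh : (z * Num.sqrt 2 - gamma) / 2 <=
    (drift (x n) n - l n) / sl n + (- 2 * (kR n * V n ^+ 2) - ln C) * (sl n)^-1.
  by near: n.
have {}hh : 0 < (drift (x n) n - l n) / sl n + (- 2 * (kR n * V n ^+ 2) - ln C) * (sl n)^-1.
  by apply: lt_le_trans hh; lra.
rewrite -mulrDl pmulr_lgt0 ?invr_gt0 // in hh.
have hq : kR n * V n ^+ 2 <= 4^-1 by near: n.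
have V2 : V n ^+ 2 <= 4^-1 by apply: le_trans hq; rewrite ler_peMl ?sqr_ge0.
have Vh : V n <= 2^-1.
  rewrite leNgt; apply/negP => hV'.
  have : 2^-1 * 2^-1 < V n * V n by apply: ltr_pM => //; rewrite ?invr_gt0.
  rewrite -expr2; lra.
have muE : mu n = rho n * lam n by rewrite /rho mulfVK // gt_eqF.
have hxV : (`|x n - lam n| + kR n) / lam n <= V n.
  rewrite /V mulrDl lerD2r ler_pdivrMr // mulrDl -[`|z| * _ * lam n]mulrA mulfVK ?gt_eqF //.
  have -> : x n - lam n = - ((1 - rho n) * lam n) + z * Num.sqrt (mu n) by rewrite /x {1}muE; ring.
  apply: le_trans (ler_normD _ _) _; rewrite normrN (normrM z) (ger0_norm (sqrtr_ge0 _)).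
  have rl : 0 <= (1 - rho n) * lam n by rewrite mulr_ge0 ?(ltW lam0) //; lra.
  by rewrite (ger0_norm rl).
have ell0 := @ell_gt0 R n (m n) (k n) n1 kn km m0 (ltnW mN) j.
have cn0 := (mulr_gt0 C0 n0).
rewrite -ltr_ln ?posrE // lnM ?posrE //.
apply: lt_le_trans (ln_ell_ge n1 kn km m0 (ltnW mN) hj hxV Vh).
move: hh; rewrite /drift /x /lam /l /kR /mR /nR; lra.
Unshelve. all: by end_near.
Qed.

Lemma draw_rate_cvg0 :
  (m n - k n)%:R / (n.-1 - k n + ('C(n, 2) - n.-1))%:R @[n --> \oo] --> (0 : R).
Proof.
apply: near_squeeze0 p0; near=> n.
have [n1 kn km m0 mN] : [/\ (1 < n)%N, (2 * k n <= n.-1)%N, (2 * k n <= m n)%N,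
  (0 < m n)%N & (m n < 'C(n, 2))%N] by near: n; exact: near_sizes.
have nN := leq_pred_bin2 n.
have -> : (n.-1 - k n + ('C(n, 2) - n.-1) = 'C(n, 2) - k n)%N by clear -kn nN; lia.
have N0 : 0 < 'C(n, 2)%:R :> R by rewrite ltr0n bin_gt0.
have N1 : 0 < ('C(n, 2) - k n)%:R :> R by rewrite ltr0n; clear -km m0 mN; lia.
rewrite ger0_norm // /p ler_pdivrMr // mulrAC ler_pdivlMr // /mR -!natrM ler_nat.
by clear -km mN; nia.
Unshelve. all: by end_near.
Qed.

Lemma star_rate_cvg0 :
  (n.-1 - k n)%:R / (n.-1 - k n + ('C(n, 2) - n.-1))%:R @[n --> \oo] --> (0 : R).
Proof.
have h : 2 * (kR n ^+ 2 / nR n) @[n --> \oo] --> (0 : R).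
  by rewrite -[0](mulr0 (2 : R)); exact: seq_cvgZ k2n.
apply: near_squeeze0 h; near=> n.
have [n1 kn km m0 mN] : [/\ (1 < n)%N, (2 * k n <= n.-1)%N, (2 * k n <= m n)%N,
  (0 < m n)%N & (m n < 'C(n, 2))%N] by near: n; exact: near_sizes.
have nN := leq_pred_bin2 n.
have -> : (n.-1 - k n + ('C(n, 2) - n.-1) = 'C(n, 2) - k n)%N by clear -kn nN; lia.
have n0 : 0 < nR n by rewrite ltr0n ltnW.
have N0 : 0 < 'C(n, 2)%:R :> R by rewrite ltr0n bin_gt0.
have N1 : 0 < ('C(n, 2) - k n)%:R :> R by rewrite ltr0n; clear -km m0 mN; lia.
rewrite ger0_norm //; apply: le_trans (_ : n.-1%:R / 'C(n, 2)%:R <= _).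
  rewrite ler_pdivrMr // mulrAC ler_pdivlMr // -!natrM ler_nat.
  by clear -nN kn; nia.
have k1 := kR1 n; have k2 : 1 <= kR n ^+ 2 by rewrite exprn_ege1.
rewrite mulrA ler_pdivrMr // mulrAC ler_pdivlMr //.
have -> : 2 * kR n ^+ 2 * 'C(n, 2)%:R = kR n ^+ 2 * (2 * 'C(n, 2)%:R) by ring.
by rewrite -bin2E // mulrC ler_peMl // mulr_ge0.
Unshelve. all: by end_near.
Qed.

Lemma edge_odds_cvg0 :
  (m n)%:R / 'C(n, 2)%:R / (1 - (m n)%:R / 'C(n, 2)%:R) @[n --> \oo] --> (0 : R).
Proof.
have q : 1 - p n @[n --> \oo] --> (1 : R).
  have h := seq_cvgDc (c := 1) (seq_cvgZ (c := -1) p0); rewrite mulr0 add0r in h.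
  by apply: (near_cvg _ h); near=> n; ring.
have h := seq_cvgM p0 (seq_cvgV (oner_neq0 R) q); rewrite mul0r in h.
exact: h.
Unshelve. all: by end_near.
Qed.

(** The mean is [k + mu <= k + lam] and the edge density is [lam / (n - 1)], so the quotient is at
    most [(k + lam)^2 / (lam (n - 1))], whose three expanded terms vanish. *)
Lemma shared_edge_cvg0 :
  (hyp_mean (n.-1 - k n) ('C(n, 2) - n.-1) (m n - k n) (fun j => (k n + j)%:R) /
    n.-1%:R) ^+ 2 / ((m n)%:R / 'C(n, 2)%:R) @[n --> \oo] --> (0 : R).
Proof.
have h := seq_cvgD (seq_cvgD (seq_cvgM A0 (cvgV0 mean_cvgy)) (seq_cvgZ (c := 2) A0)) p0.
rewrite mul0r mulr0 !addr0 in h.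
apply: near_squeeze0 h; near=> n.
have [n1 kn km m0 mN] : [/\ (1 < n)%N, (2 * k n <= n.-1)%N, (2 * k n <= m n)%N,
  (0 < m n)%N & (m n < 'C(n, 2))%N] by near: n; exact: near_sizes.
have [_ _ _ lam0 _] : [/\ 0 < nR n, 1 <= l n, 2^-1 <= y n, 0 < lam n &
  lam n = kR n ^+ 2 * y n / (2 * l n)] by near: n.
have [_ /andP[r0 r1]] : 1 - rho n <= (A n + B n) / kR n /\ 0 < rho n <= 1 by near: n.
have nN := leq_pred_bin2 n; have kp := k_gt0 n.
have K0 := n1_gt0 n1; have k1 := kR1 n; have kR0 : 0 < kR n by exact: lt_le_trans k1.
have muE : mu n = rho n * lam n by rewrite /rho mulfVK // gt_eqF.
have mu0 : 0 < mu n by rewrite muE mulr_gt0.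
have mul : mu n <= lam n by rewrite muE ler_piMl // ltW.
have -> : hyp_mean (n.-1 - k n) ('C(n, 2) - n.-1) (m n - k n) (fun j => (k n + j)%:R) =
    kR n + mu n.
  rewrite (eq_hyp_mean _ _ _ (G := fun j => kR n + j%:R)); last by move=> j; rewrite natrD.
  have hM : (m n - k n <= n.-1 - k n + ('C(n, 2) - n.-1))%N by clear -kn mN nN; lia.
  rewrite hyp_meanD hyp_mean_const // hyp_mean_id //; first by clear -kn kp; lia.
  by clear -km kp; lia.
rewrite -/(mR n) -/(p n) pE // ger0_norm; last first.
  by apply: divr_ge0; rewrite ?sqr_ge0 //; apply: divr_ge0; rewrite ltW.
apply: le_trans (_ : ((kR n + lam n) / n.-1%:R) ^+ 2 / (lam n / n.-1%:R) <= _).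
  rewrite ler_pM2r ?invr_gt0 ?(divr_gt0 lam0 K0) //.
  apply: lerXn2r; rewrite ?nnegrE.
  - by apply: divr_ge0; rewrite ?(ltW K0) //; apply: addr_ge0; rewrite ltW.
  - by apply: divr_ge0; rewrite ?(ltW K0) //; apply: addr_ge0; rewrite ltW.
  by rewrite ler_pM2r ?invr_gt0 // lerD2l.
have -> : ((kR n + lam n) / n.-1%:R) ^+ 2 / (lam n / n.-1%:R) =
  A n * (lam n)^-1 + 2 * (kR n / n.-1%:R) + lam n / n.-1%:R.
  rewrite /A; move: K0 lam0; move: (n.-1%:R : R) (lam n) (kR n) => a b c a0 b0.
  by field; rewrite !gt_eqF.
have A_ge0 : 0 <= A n by apply: divr_ge0; rewrite ?sqr_ge0 // ltW.
rewrite lerD2r; apply: lerD.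
  by rewrite ler_wpM2l // lef_pV2 ?posrE.
by rewrite ler_pM2l // ler_pM2r ?invr_gt0 // expr2 ler_peMr // ltW.
Unshelve. all: by end_near.
Qed.

End Asymptotics.

(** * From the central limit theorem to total variation *)

Section TailMass.
Variables (R : realType) (n m k : nat) (x : R).
Hypothesis hM : (m - k <= n.-1 - k + ('C(n, 2) - n.-1))%N.

Let cdf := hyp_mean (n.-1 - k) ('C(n, 2) - n.-1) (m - k) (fun j => (j%:R <= x)%R%:R : R).

Let ccdfE : 1 - cdf =
  hyp_mean (n.-1 - k) ('C(n, 2) - n.-1) (m - k) (fun j => 1 + -1 * (j%:R <= x)%R%:R).
Proof. by rewrite hyp_meanD hyp_meanZ hyp_mean_const // mulN1r. Qed.

Lemma tail_mass_le c : (forall j, j%:R <= x -> ell R n m k (k + j) <= c) ->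
  tail_mass n m k c <= 1 - cdf.
Proof.
move=> h; rewrite ccdfE; apply: ler_hyp_mean => j _.
case hj : (j%:R <= x)%R; last by case: (_ < _)%R; rewrite /= mulr0 addr0 ?lexx ?ler01.
by rewrite ltNge h //= mulr1 subrr.
Qed.

Lemma tail_mass_ge c : (forall j, x <= j%:R -> c < ell R n m k (k + j)) ->
  1 - cdf <= tail_mass n m k c.
Proof.
move=> h; rewrite ccdfE; apply: ler_hyp_mean => j _.
case: (lerP j%:R x) => hj /=; first by rewrite mulr1 subrr ler0n.
by rewrite h ?(ltW hj) //= mulr0 addr0.
Qed.

End TailMass.

Theorem mainTheorem1 (R : realType) (k m : nat -> nat) (gamma : R) :
  (forall n, (0 < k n)%N) ->
  (fun n => ln (n%:R : R) ^+ 2 / (k n)%:R) @ \oo --> (0 : R) ->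
  (fun n => (k n)%:R / Num.sqrt (n%:R : R)) @ \oo --> (0 : R) ->
  (\forall n \near \oo,
     `|(m n)%:R - ((k n)%:R ^+ 2 * n%:R / (4 * ln (n%:R : R)))
                   * (1 + gamma / Num.sqrt (ln (n%:R : R)))| < 1) ->
  (fun n => TV (@P1 R n (m n) (k n)) (@P0 R n (m n))) @ \oo -->
    1 - Phi (gamma / Num.sqrt 2).
Proof.
move=> k0 log_k k_sqrt m_near; apply/cvgrPdist_le => /= e e0.
set g0 := gamma / _.
have s2 : 0 < Num.sqrt 2 :> R by rewrite sqrtr_gt0.
have e4 : 0 < e / 4 by rewrite divr_gt0.
have e8 : 0 < e / 8 by rewrite divr_gt0.
have sizes := near_sizes k0 log_k k_sqrt m_near.
have clt z := hyp_clt (z := z) (mean_cvgy k0 log_k k_sqrt m_near)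
  (draw_rate_cvg0 k0 log_k k_sqrt m_near) (star_rate_cvg0 k0 log_k k_sqrt m_near).
have odds := edge_odds_cvg0 k0 log_k k_sqrt m_near.
have shared := shared_edge_cvg0 k0 log_k k_sqrt m_near.
have [d d0 hd] : exists2 d : R, 0 < d & forall z, `|g0 - z| < d -> `|Phi g0 - Phi z| <= e / 4.
  have /cvgrPdist_le/(_ _ e4)/nbhs_ballP[d d0 hd] := @Phi_continuous R g0.
  by exists d.
have dd : 0 < d / 2 by rewrite divr_gt0.
(* The estimates of [ell] need a strict gap from [gamma / sqrt 2]; continuity of [Phi] makes the
   shift harmless. *)
pose zl := g0 - d / 2; pose zr := g0 + d / 2.
have hzl : `|Phi g0 - Phi zl| <= e / 4.
  by apply: hd; rewrite /zl opprB addrCA subrr addr0 gtr0_norm //; lra.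
have hzr : `|Phi g0 - Phi zr| <= e / 4.
  by apply: hd; rewrite /zr opprD addrA subrr sub0r normrN gtr0_norm //; lra.
have zlg : zl * Num.sqrt 2 < gamma by rewrite -ltr_pdivlMr // -/g0 /zl; lra.
have zrg : gamma < zr * Num.sqrt 2 by rewrite -ltr_pdivrMr // -/g0 /zr; lra.
(* The three variance terms are at most [eps] each, so divided by [delta = e / 8] they total at most
   [e / 8]; likewise [C] makes [1 / C = e / 8]. *)
pose de := e / 8; pose eps := de ^+ 2 / 3.
have eps0 : 0 < eps by rewrite divr_gt0 // exprn_gt0.
pose C := (e / 8)^-1.
have C0 : 0 < C by rewrite invr_gt0.
have upper := near_ell_le k0 log_k k_sqrt m_near zlg eps0.
have lower := near_ell_gt k0 log_k k_sqrt m_near zrg C0.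
have /cvgrPdist_le/(_ _ e8) cl := clt zl; have /cvgrPdist_le/(_ _ e8) cr := clt zr.
have odds1 := near_le_cst odds eps0; have shared1 := near_le_cst shared eps0.
pose mu n : R := (n.-1 - k n)%:R * (m n - k n)%:R / (n.-1 - k n + ('C(n, 2) - n.-1))%:R.
near=> n.
have [n1 kn km m0 mN] : [/\ (1 < n)%N, (2 * k n <= n.-1)%N, (2 * k n <= m n)%N,
  (0 < m n)%N & (m n < 'C(n, 2))%N] by near: n.
have nN := leq_pred_bin2 n.
have kn' : (k n <= n.-1)%N by clear -kn; lia.
have km' : (k n <= m n)%N by clear -km; lia.
have hM : (m n - k n <= n.-1 - k n + ('C(n, 2) - n.-1))%N by clear -kn mN nN; lia.
have hU : forall j, j%:R <= mu n + zl * Num.sqrt (mu n) ->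
    ell R n (m n) (k n) (k n + j) <= eps * n%:R by near: n.
have hL : forall j, mu n + zr * Num.sqrt (mu n) <= j%:R ->
    C * n%:R < ell R n (m n) (k n) (k n + j) by near: n.
have u1 := TV_le_tail_mass n1 kn' km' m0 mN eps0 e8.
have l1 := TV_ge_tail_mass n1 kn' km' m0 mN C0.
have u2 := tail_mass_le hM hU; have l2 := tail_mass_ge hM hL.
have cl' : `|Phi zl - hyp_mean (n.-1 - k n) ('C(n, 2) - n.-1) (m n - k n)
   (fun j => (j%:R <= mu n + zl * Num.sqrt (mu n))%R%:R)| <= e / 8 by near: n.
have cr' : `|Phi zr - hyp_mean (n.-1 - k n) ('C(n, 2) - n.-1) (m n - k n)
   (fun j => (j%:R <= mu n + zr * Num.sqrt (mu n))%R%:R)| <= e / 8 by near: n.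
have o1 : (m n)%:R / 'C(n, 2)%:R / (1 - (m n)%:R / 'C(n, 2)%:R) <= eps by near: n.
have o2 : (hyp_mean (n.-1 - k n) ('C(n, 2) - n.-1) (m n - k n) (fun j => (k n + j)%:R) /
    n.-1%:R) ^+ 2 / ((m n)%:R / 'C(n, 2)%:R) <= eps by near: n.
have o3 : (eps + (m n)%:R / 'C(n, 2)%:R / (1 - (m n)%:R / 'C(n, 2)%:R) +
   (hyp_mean (n.-1 - k n) ('C(n, 2) - n.-1) (m n - k n) (fun j => (k n + j)%:R) /
    n.-1%:R) ^+ 2 / ((m n)%:R / 'C(n, 2)%:R)) / (e / 8) <= e / 8.
  rewrite ler_pdivrMr //; have -> : e / 8 * (e / 8) = eps + eps + eps.
    by rewrite /eps /de; field.
  by apply: lerD => //; apply: lerD.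
have u3 := le_trans u1 (lerD (lexx _) o3).
rewrite /C invrK in l1.
move: cl' cr' hzl hzr u2 u3 l1 l2.
set F1 := hyp_mean _ _ _ _; set F2 := hyp_mean _ _ _ _.
move: (tail_mass _ _ _ _) (tail_mass _ _ _ _) F1 F2 (TV _ _) (Phi g0) (Phi zl) (Phi zr).
move: e0; clear=> e0 t1 t2 F1 F2 T p pl pr; rewrite !ler_norml.
move=> /andP[? ?] /andP[? ?] /andP[? ?] /andP[? ?] *.
by apply/andP; split; lra.
Unshelve. all: by end_near.
Qed.
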